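(* Let $n\ge1$ and $\sigma>0$ with $n=2\sigma$, and let $w:\mathbb{R}^n\setminus\{0\}\to\mathbb{R}$ be smooth, homogeneous of degree $\sigma$, of maximal rank (as defined in the context), with $w(\xi)>0$ for $\xi\ne0$. Let $a\in\mathcal{C}^{n+1}(\mathbb{R}^n\setminus\{0\})$ with $a(\xi)>0$ for $\xi\neq0$, and assume that for some $\theta_0>\sigma$, $a_0>0$, $C>0$, $$a(\xi)\ge a_0|\xi|^{\theta_0},\qquad|\partial_\xi^\gamma a(\xi)|\le C|\xi|^{\theta_0-|\gamma|},\quad|\gamma|\le n+1,$$ in a neighborhood of the origin. Let $\chi\in\mathcal{C}_c^\infty(\mathbb{R}^n)$ with $\chi=1$ in a neighborhood of the origin and $T_\chi f=\mathscr{F}^{-1}(\chi\hat f)$. For $u_1\in L^1(\mathbb{R}^n)$ let $u$ be the solution of $u_{tt}+L_{w^2}u+Au_t=0$, $u(0,\cdot)=0$, $u_t(0,\cdot)=u_1$, given by the formula in the context. Then there is a constant $C'>0$, independent of $t$ and $u_1$, such that $$\|T_\chi u(t,\cdot)\|_{L^2}\le C'\big(1+(\log t)_+\big)^{\frac12}\|u_1\|_{L^1},\quad t\ge0.$$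
   Context: $w$ has maximal rank if its Hessian matrix $H_w(\xi)$ satisfies, for all $\xi\neq0$: $\det H_w(\xi)\ne0$ when $\sigma\ne1$, and $\operatorname{rank}H_w(\xi)=n-1$ when $\sigma=1$. $(r)_+=\max\{r,0\}$ (so $(\log t)_+=0$ for $0\le t\le1$). Hats and $\mathscr{F}$ denote Fourier transform with respect to $x\in\mathbb{R}^n$; $L_{w^2}u=\mathscr{F}^{-1}(w(\xi)^2\hat u)$, $Au=\mathscr{F}^{-1}(a(\xi)\hat u)$, $\mathrm{sinc}\,\rho=\rho^{-1}\sin\rho$. Solution formula: $\hat u$ solves $\hat u_{tt}+w(\xi)^2\hat u+a(\xi)\hat u_t=0$, $\hat u(0,\xi)=0$, $\hat u_t(0,\xi)=\hat u_1(\xi)$, i.e. if $a(\xi)^2<4w(\xi)^2$, $$\hat u(t,\xi)=e^{-a(\xi)t/2}\,t\,\mathrm{sinc}\big(tw(\xi)\sqrt{1-\tilde a(\xi)}\big)\hat u_1(\xi),\qquad\tilde a(\xi)=\frac{a(\xi)^2}{4w(\xi)^2},$$ and if $a(\xi)^2\ge4w(\xi)^2$, $$\hat u(t,\xi)=\frac{e^{\lambda_+t}-e^{\lambda_-t}}{\lambda_+-\lambda_-}\hat u_1(\xi),\qquad\lambda_\pm=\frac{-a(\xi)\pm\sqrt{a(\xi)^2-4w(\xi)^2}}2,$$ intended as its limit $te^{-w(\xi)t}\hat u_1(\xi)$ when $a(\xi)=2w(\xi)$. *)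

(* Defs.v *)
From HB Require Import structures.
From mathcomp Require Import all_boot all_order all_algebra.
From mathcomp Require Import all_classical all_reals all_analysis.
From mathcomp Require Import complex.

Set Implicit Arguments.
Unset Strict Implicit.
Unset Printing Implicit Defensive.

Import Order.TTheory GRing.Theory Num.Theory.
Import numFieldNormedType.Exports.

Local Open Scope classical_set_scope.
Local Open Scope ring_scope.
Local Open Scope complex_scope.

(* The product sigma-algebra on row vectors; for the reals it is the Borel
   sigma-algebra of R^n. *)
Section measurable_rV.
Context (R : realType) (n : nat).

Let coord : 'I_n -> 'rV[R]_n -> R := fun i x => x 0 i.

Let rV_set0 : g_sigma_preimage coord set0.
Proof. exact: sigma_algebra0. Qed.

Let rV_setC A : g_sigma_preimage coord A -> g_sigma_preimage coord (~` A).
Proof. exact: sigma_algebraC. Qed.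

Let rV_bigcup (F : _^nat) : (forall i, g_sigma_preimage coord (F i)) ->
  g_sigma_preimage coord (\bigcup_i (F i)).
Proof. exact: sigma_algebra_bigcup. Qed.

HB.instance Definition _ := @isMeasurable.Build default_measure_display
  'rV[R]_n (g_sigma_preimage coord) rV_set0 rV_setC rV_bigcup.

End measurable_rV.

Lemma measurable_fun_rVP (R : realType) d (T : measurableType d) n
    (f : T -> 'rV[R]_n) :
  (forall i, measurable_fun [set: T] (fun x => f x 0 i)) ->
  measurable_fun [set: T] f.
Proof.
move=> mf.
have H : g_sigma_preimage (fun i x => f x 0 i) `<=` measurable.
  apply: smallest_sub; first exact: sigma_algebra_measurable.
  case: n f mf => [|n] f mf; first by rewrite big_ord0.
  rewrite -bigcup_mkord_ord; apply: bigcup_sub => i Ii.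
  by move=> A [B mB <-]; exact: mf.
move=> _ A mA; apply: H.
rewrite (_ : g_sigma_preimage _ =
  preimage_set_system [set: T] f (g_sigma_preimage (fun i (x : 'rV[R]_n) => x 0 i))).
  by exists A.
by rewrite -g_sigma_preimage_comp.
Qed.

Lemma measurable_coord_rV (R : realType) n (i : 'I_n) :
  measurable_fun [set: 'rV[R]_n] (fun x : 'rV[R]_n => x 0 i).
Proof.
move=> _ Y mY; rewrite setTI; apply: sub_sigma_algebra => /=.
rewrite -bigcup_seq/=; exists i => /=; first by rewrite mem_index_enum.
by exists Y => //; rewrite setTI.
Qed.

Section lebesgue_rV.
Context (R : realType).

Definition cons_rV n (p : measurableTypeR R * 'rV[R]_n) : 'rV[R]_n.+1 :=
  \row_i (if unlift ord0 i is Some j then p.2 0 j else p.1).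

Definition behead_rV n (x : 'rV[R]_n.+1) : measurableTypeR R * 'rV[R]_n :=
  (x 0 ord0, \row_j x 0 (lift ord0 j)).

Lemma cons_rV0 n (p : measurableTypeR R * 'rV[R]_n) :
  cons_rV p 0 ord0 = p.1.
Proof. by rewrite mxE unlift_none. Qed.

Lemma cons_rV_lift n (p : measurableTypeR R * 'rV[R]_n) j :
  cons_rV p 0 (lift ord0 j) = p.2 0 j.
Proof. by rewrite mxE liftK. Qed.

Lemma cons_rVK n : cancel (@cons_rV n) (@behead_rV n).
Proof.
move=> [a v]; rewrite /behead_rV cons_rV0; congr pair.
by apply/rowP => j; rewrite mxE cons_rV_lift.
Qed.

Lemma behead_rVK n : cancel (@behead_rV n) (@cons_rV n).
Proof.
move=> x; apply/rowP => i.
have [j ->|->] := unliftP ord0 i; first by rewrite cons_rV_lift mxE.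
by rewrite cons_rV0.
Qed.

Lemma measurable_cons_rV n :
  measurable_fun [set: measurableTypeR R * 'rV[R]_n] (@cons_rV n).
Proof.
apply: measurable_fun_rVP => i.
have [j ->|->] := unliftP ord0 i.
  under eq_fun do rewrite cons_rV_lift.
  apply: (measurableT_comp (measurable_coord_rV j)); exact: measurable_snd.
under eq_fun do rewrite cons_rV0.
exact: measurable_fst.
Qed.

Lemma measurable_behead_rV n :
  measurable_fun [set: 'rV[R]_n.+1] (@behead_rV n).
Proof.
apply: measurable_fun_pair; first exact: measurable_coord_rV.
apply: measurable_fun_rVP => i; under eq_fun do rewrite mxE.
exact: measurable_coord_rV.
Qed.

Section step.
Context n (mu : {sigma_finite_measure set 'rV[R]_n -> \bar R}).

Definition lebesgue_rV_step : set 'rV[R]_n.+1 -> \bar R :=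
  pushforward (@lebesgue_measure R \x mu)%E (@cons_rV n).

Let step0 : lebesgue_rV_step set0 = 0%E.
Proof. by rewrite /lebesgue_rV_step /pushforward preimage_set0 measure0. Qed.

Let step_ge0 A : (0 <= lebesgue_rV_step A)%E.
Proof. by rewrite /lebesgue_rV_step /pushforward measure_ge0. Qed.

Let step_sigma_additive : semi_sigma_additive lebesgue_rV_step.
Proof.
move=> F mF tF mUF; rewrite /lebesgue_rV_step /pushforward preimage_bigcup.
apply: measure_semi_sigma_additive.
- by move=> k; rewrite -[X in measurable X]setTI; exact: measurable_cons_rV.
- apply/trivIsetP => /= i j _ _ ij; rewrite -preimage_setI.
  by move/trivIsetP : tF => /(_ _ _ _ _ ij) ->//; rewrite preimage_set0.
- by rewrite -preimage_bigcup -[X in measurable X]setTI; exact: measurable_cons_rV.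
Qed.

HB.instance Definition _ := isMeasure.Build _ _ _ lebesgue_rV_step
  step0 step_ge0 step_sigma_additive.

Let step_sigma_finite : sigma_finite setT lebesgue_rV_step.
Proof.
have /sigma_finiteP[F [TF ndF Foo]] := sigma_finiteT (@lebesgue_measure R).
have /sigma_finiteP[G [TG ndG Goo]] := sigma_finiteT mu.
exists (fun k => @behead_rV n @^-1` (F k `*` G k)).
  rewrite -preimage_bigcup (_ : \bigcup_k _ = setT) ?preimage_setT//.
  apply/seteqP; split => // -[x y] _.
  have [k _ Fkx] : (\bigcup_k F k) x by rewrite -TF.
  have [l _ Gly] : (\bigcup_k G k) y by rewrite -TG.
  exists (maxn k l) => //; split => /=.
    by move: x Fkx; exact/subsetPset/ndF/leq_maxl.
  by move: y Gly; exact/subsetPset/ndG/leq_maxr.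
move=> k; have [mFk Fk] := Foo k; have [mGk Gk] := Goo k; split.
  by rewrite -[X in measurable X]setTI; apply: measurable_behead_rV => //;
    exact: measurableX.
rewrite /lebesgue_rV_step /pushforward -comp_preimage.
rewrite (_ : @behead_rV n \o _ = id); last exact/funext/cons_rVK.
by rewrite preimage_id product_measure1E// lte_mul_pinfty// ge0_fin_numE.
Qed.

HB.instance Definition _ := Measure_isSigmaFinite.Build _ _ _ lebesgue_rV_step
  step_sigma_finite.

End step.

Fixpoint lebesgue_rV n : {sigma_finite_measure set 'rV[R]_n -> \bar R} :=
  if n is m.+1 then lebesgue_rV_step (lebesgue_rV m) else dirac (0 : 'rV[R]_0).

End lebesgue_rV.

Lemma lebesgue_rV_box (R : realType) n (A : 'I_n -> set R) :
  (forall i, measurable (A i)) ->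
  (lebesgue_rV R n [set x : 'rV[R]_n | forall i, A i (x 0%R i)]
   = \prod_(i < n) lebesgue_measure (A i))%E.
Proof.
elim: n A => [|n IH] A mA.
  by rewrite big_ord0 /= diracE mem_set// => -[].
have mbox : measurable [set x : 'rV[R]_n | forall i, A (lift ord0 i) (x 0 i)].
  rewrite (_ : mkset _ =
      \bigcap_(i in setT) ((fun x : 'rV[R]_n => x 0 i) @^-1` A (lift ord0 i))).
    apply: fin_bigcap_measurable => // i _; rewrite -[X in measurable X]setTI.
    exact: measurable_coord_rV.
  by apply/seteqP; split => x h i; [move=> _; exact: h|exact: h].
rewrite big_ord_recl -IH//= /lebesgue_rV_step /pushforward.
rewrite -product_measure1E//; last exact: mA.
congr (product_measure1 _ _ _).
apply/seteqP; split => -[x y] /= h.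
  split; first by have := h ord0; rewrite cons_rV0.
  by move=> i; have := h (lift ord0 i); rewrite cons_rV_lift.
move=> i; have [j ->|->] := unliftP ord0 i; last by rewrite cons_rV0; exact: h.1.
by rewrite cons_rV_lift; exact: h.2.
Qed.

Section calculus.
Context (R : realType) (n : nat).
Implicit Types (f : 'rV[R]_n -> R) (U : set 'rV[R]_n).

Definition dotp (x y : 'rV[R]_n) : R := \sum_i x 0 i * y 0 i.

(* The library norm on 'rV[R]_n is the sup norm. *)
Definition enorm (x : 'rV[R]_n) : R := Num.sqrt (dotp x x).

Definition punctured : set 'rV[R]_n := [set x | x != 0].

Definition partial (i : 'I_n) f : 'rV[R]_n -> R :=
  fun x => 'D_(delta_mx 0 i) f x.

(* U is meant to be open: the values of f outside U are irrelevant. *)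
Fixpoint Ck_on (k : nat) U f : Prop :=
  (forall x, U x -> {for x, continuous f}) /\
  if k is k'.+1 then
    forall i, (forall x, U x -> derivable f x (delta_mx 0 i)) /\
              Ck_on k' U (partial i f)
  else True.

Definition smooth_on U f : Prop := forall k, Ck_on k U f.

Definition multi_order (g : 'I_n -> nat) : nat := (\sum_i g i)%N.

Definition multi_partial (g : 'I_n -> nat) f : 'rV[R]_n -> R :=
  foldr (fun i h => iter (g i) (partial i) h) f (enum 'I_n).

Definition hessian f (x : 'rV[R]_n) : 'M[R]_n :=
  \matrix_(i, j) partial i (partial j f) x.

Definition homogeneous (sigma : R) f : Prop :=
  forall (l : R) x, 0 < l -> x != 0 -> f (l *: x) = l `^ sigma * f x.

Definition maximal_rank (sigma : R) f : Prop :=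
  forall x, x != 0 ->
    (sigma != 1 -> \det (hessian f x) != 0) /\
    (sigma = 1 -> \rank (hessian f x) = (n - 1)%N).

End calculus.

Section fourier.
Context (R : realType) (n : nat).
Implicit Types f g chi : 'rV[R]_n -> R[i].

Local Notation mu := (lebesgue_rV R n).

Definition in_L1 f : Prop :=
  mu.-integrable setT (fun x => (complex.Re (f x))%:E) /\
  mu.-integrable setT (fun x => (complex.Im (f x))%:E).

Definition Lp_norm (p : \bar R) f : \bar R :=
  Lnorm mu p (fun x => (Normc.normc (f x))%:E).

Definition cintegral f : R[i] :=
  (\int[mu]_x complex.Re (f x)) +i* (\int[mu]_x complex.Im (f x)).

Definition expi (r : R) : R[i] := cos r +i* sin r.

Definition fourier f : 'rV[R]_n -> R[i] :=
  fun xi => cintegral (fun x => expi (- dotp x xi) * f x).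

Definition inv_fourier g : 'rV[R]_n -> R[i] :=
  fun x => ((2 * pi) ^- n)%:C * cintegral (fun xi => expi (dotp x xi) * g xi).

(* C_c^oo(R^n), complex valued. *)
Definition test_function chi : Prop :=
  [/\ smooth_on setT (fun x => complex.Re (chi x)),
      smooth_on setT (fun x => complex.Im (chi x)) &
      compact (closure [set x | chi x != 0])].

(* T_chi f, as a function of the Fourier transform of f: the solution u below is
   given by its Fourier transform, which is merely bounded, so that u itself is
   in general only a tempered distribution, whereas chi * fhat is integrable. *)
Definition T_cutoff chi (fhat : 'rV[R]_n -> R[i]) : 'rV[R]_n -> R[i] :=
  inv_fourier (fun xi => chi xi * fhat xi).

End fourier.

Section solution.
Context (R : realType) (n : nat).
Implicit Types (w a : 'rV[R]_n -> R) (t : R) (xi : 'rV[R]_n).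

Definition sinc (r : R) : R := if r == 0 then 1 else r^-1 * sin r.

Definition a_tilde w a xi : R := a xi ^+ 2 / (4 * w xi ^+ 2).

Definition lambda_plus w a xi : R :=
  (- a xi + Num.sqrt (a xi ^+ 2 - 4 * w xi ^+ 2)) / 2.

Definition lambda_minus w a xi : R :=
  (- a xi - Num.sqrt (a xi ^+ 2 - 4 * w xi ^+ 2)) / 2.

Definition propagator w a t xi : R :=
  if a xi ^+ 2 < 4 * w xi ^+ 2 then
    expR (- a xi * t / 2) * t * sinc (t * w xi * Num.sqrt (1 - a_tilde w a xi))
  else if a xi == 2 * w xi then t * expR (- w xi * t)
  else (expR (lambda_plus w a xi * t) - expR (lambda_minus w a xi * t))
         / (lambda_plus w a xi - lambda_minus w a xi).

(* The Fourier transform in x of the solution of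
   u_tt + L_{w^2} u + A u_t = 0, u(0) = 0, u_t(0) = u1. *)
Definition u_hat w a (u1 : 'rV[R]_n -> R[i]) t : 'rV[R]_n -> R[i] :=
  fun xi => (propagator w a t xi)%:C * fourier u1 xi.

End solution.

Definition pos_part (R : realType) (r : R) : R := Num.max r 0.

(* Main.v *)
Require Import Defs.
From HB Require Import structures.
From mathcomp Require Import all_boot all_order all_algebra.
From mathcomp Require Import all_classical all_reals all_analysis.
From mathcomp Require Import measurable_realfun.
From mathcomp Require Import complex.
From mathcomp Require Import ring lra.

Set Implicit Arguments.
Unset Strict Implicit.
Unset Printing Implicit Defensive.

Import Order.TTheory GRing.Theory Num.Theory.
Import numFieldNormedType.Exports.

Local Open Scope classical_set_scope.
Local Open Scope ring_scope.
Local Open Scope complex_scope.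

(** Plancherel's inequality and the bound $|\hat u_1|\le C\|u_1\|_{L^1}$ reduce
    the estimate to $\int|\chi(\xi)|^2m(t,\xi)^2\,d\xi\le C(1+(\log t)_+)$, where $m$
    is the propagator, that is the displacement of the damped oscillator of the
    Fourier mode $\xi$, released at rest position with unit speed.

    The oscillator dissipates energy, so its speed never exceeds one and its
    displacement is at most of order $1/w$: $|m|\le\min(t,2/w)$
    ([propagator_le]). By homogeneity and compactness of the unit sphere,
    $w(\xi)\ge c|\xi|^\sigma$, and $n=2\sigma$ turns this into
    $w(\xi)^2\ge c|\xi|^n$ ([homogeneous_sqr_ge]). Hence
    $m^2\le C\min(t^2,|\xi|^{-n})$. The power $|\xi|^{-n}$ is exactly critical:
    each dyadic shell contributes the same amount. The shells are only needed
    down to $|\xi|^n\sim t^{-2}$, below which $m^2\le t^2$ has a bounded integral;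
    there are about $\log t$ of them, and this is the logarithm
    ([integral_dyadic_le], [integral_log_le]).

    Plancherel's inequality is needed only up to a constant
    ([inv_fourier_L2_le]). For an integrable real function $A$, the square of the
    modulus of its Fourier transform is integrated against the product
    window $\prod_i(1-|x_i|/N)_+$. By Fubini's theorem this is
    $\iint A(y)A(z)K_N(y-z)\,dy\,dz$, where $K_N$ is a product of Fejer kernels,
    which are nonnegative with an integral bounded independently of $N$; Schur's
    test bounds it by $C\int A^2$ ([integral_window_energy_le]). Monotone
    convergence as $N\to\infty$ removes the window ([transform_L2_le]). *)

(** * Lebesgue measure and measurability on row vectors *)

Section parametric_integral.
Context d1 d2 (T1 : measurableType d1) (T2 : measurableType d2) (R : realType).
Variable m2 : {sigma_finite_measure set T2 -> \bar R}.

(** This serves for the Fourier integrals, whose integrands are signed and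
    depend measurably on the frequency and the position jointly. *)
Lemma measurable_parametric_integral (f : T1 * T2 -> \bar R) :
  measurable_fun [set: T1 * T2] f ->
  measurable_fun setT (fun x => (\int[m2]_y f (x, y))%E).
Proof.
move=> mf.
have -> : (fun x => \int[m2]_y f (x, y))%E =
    ((fun x => \int[m2]_y f^\+ (x, y)) \- (fun x => \int[m2]_y f^\- (x, y)))%E.
  apply/funext => x; rewrite [LHS]integralE.
  under eq_integral do rewrite funepos_comp/=.
  by under [X in (_ - X = _)%E]eq_integral do rewrite funeneg_comp/=.
apply: emeasurable_funB.
- by apply: (measurable_fun_fubini_tonelli_F f^\+%E) => //; exact: measurable_funepos.
- by apply: (measurable_fun_fubini_tonelli_F f^\-%E) => //; exact: measurable_funeneg.
Qed.

Lemma measurable_parametric_Rintegral (f : T1 * T2 -> R) :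
  measurable_fun [set: T1 * T2] f ->
  measurable_fun setT (fun x => \int[m2]_y f (x, y)).
Proof.
move=> mf; apply: (measurableT_comp (@fine_measurable R setT measurableT)).
by apply: (measurable_parametric_integral (f := EFin \o f)); exact/measurable_EFinP.
Qed.

End parametric_integral.

Section lebesgue_rV_fubini.
Context (R : realType) (n : nat).

Lemma ge0_integral_lebesgue_rVS (f : 'rV[R]_n.+1 -> \bar R) :
  measurable_fun setT f -> (forall x, 0 <= f x)%E ->
  (\int[lebesgue_rV R n.+1]_x f x =
   \int[@lebesgue_measure R]_a \int[lebesgue_rV R n]_v f (cons_rV (a, v)))%E.
Proof.
move=> mf f0.
rewrite [LHS](ge0_integral_pushforward (@measurable_cons_rV R n)) ?preimage_setT//.
rewrite (fubini_tonelli1 (f \o @cons_rV R n))//=.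
exact: (measurableT_comp mf (@measurable_cons_rV R n)).
Qed.

Lemma integral_lebesgue_rVS (f : 'rV[R]_n.+1 -> \bar R) :
  (lebesgue_rV R n.+1).-integrable setT f ->
  (\int[lebesgue_rV R n.+1]_x f x =
   \int[@lebesgue_measure R]_a \int[lebesgue_rV R n]_v f (cons_rV (a, v)))%E.
Proof.
move=> /integrableP[mf foo].
have if' : (@lebesgue_measure R \x lebesgue_rV R n)%E.-integrable setT
    (f \o @cons_rV R n).
  apply/integrableP; split.
    exact: (measurableT_comp mf (@measurable_cons_rV R n)).
  move: foo; rewrite [X in (X < _)%E -> _]
    (ge0_integral_pushforward (@measurable_cons_rV R n)) ?preimage_setT//.
  exact: measurableT_comp.
rewrite [LHS](integral_pushforward (@measurable_cons_rV R n)) ?preimage_setT//.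
by rewrite -(integral12_prod_meas1 if').
Qed.

End lebesgue_rV_fubini.

Section dotp_theory.
Context (R : realType).

Lemma measurable_dotp n :
  measurable_fun setT (fun p : 'rV[R]_n * 'rV[R]_n => dotp p.1 p.2).
Proof.
apply: measurable_sum => i; apply: measurable_funM.
  exact: (measurableT_comp (measurable_coord_rV i) measurable_fst).
exact: (measurableT_comp (measurable_coord_rV i) measurable_snd).
Qed.

Lemma measurable_dotpr n (x : 'rV[R]_n) : measurable_fun setT (fun z => dotp x z).
Proof.
apply: measurable_sum => i; apply: measurable_funM; first exact: measurable_cst.
exact: measurable_coord_rV.
Qed.

Lemma dotp_cons n a (v : 'rV[R]_n) (z : 'rV[R]_n.+1) :
  dotp (cons_rV (a, v)) z = a * z 0 ord0 + dotp v (\row_j z 0 (lift ord0 j)).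
Proof.
rewrite /dotp big_ord_recl cons_rV0; congr (_ + _).
by apply: eq_bigr => i _; rewrite cons_rV_lift mxE.
Qed.

Lemma dotpBr n (x y z : 'rV[R]_n) : dotp x (y - z) = dotp x y - dotp x z.
Proof. by rewrite /dotp -sumrB; apply: eq_bigr => i _; rewrite !mxE mulrBr. Qed.

Lemma dotpC n (x y : 'rV[R]_n) : dotp x y = dotp y x.
Proof. by apply: eq_bigr => i _; rewrite mulrC. Qed.

End dotp_theory.

Section open_measurable_rV.
Context (R : realType) (n : nat).

(** The open cubes with rational centre and radius $1/(k+1)$ form a countable
    base, whence the product sigma-algebra contains all open sets. *)
Let qcube (c : 'rV[rat]_n * nat) : set 'rV[R]_n :=
  [set x | forall i, `|ratr (c.1 0 i) - x 0 i| < c.2.+1%:R^-1].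

Let measurable_qcube c : measurable (qcube c).
Proof.
rewrite (_ : qcube c = \bigcap_(i in setT) ((fun x : 'rV[R]_n => x 0 i) @^-1`
   ball (ratr (c.1 0 i) : R) c.2.+1%:R^-1)).
  apply: fin_bigcap_measurable => // i _; rewrite -[X in measurable X]setTI.
  by apply: measurable_coord_rV => //; exact: measurable_ball.
by apply/seteqP; split => [x h i _|x h i]; exact: h.
Qed.

Lemma open_measurable_rV (U : set 'rV[R]_n) : open U -> measurable U.
Proof.
move=> oU.
rewrite (_ : U = \bigcup_c (if `[< qcube c `<=` U >] then qcube c else set0)).
  apply: countable_bigcupT_measurable => [|c]; first exact: countableP.
  by case: ifPn.
apply/seteqP; split; last first.
  by move=> x [c _]; case: ifPn => // /asboolP; apply.
move=> x Ux.
have /nbhs_ballP[e /= e0 xeU] : nbhs x U by exact: open_nbhs_nbhs.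
pose k := Num.truncn (2 / e).
have ke : k.+1%:R^-1 < e / 2.
  by rewrite invf_plt ?posrE ?divr_gt0// invf_div truncnS_gt.
have /choice[q qx] : forall i, exists q, `|ratr q - x 0 i| < k.+1%:R^-1.
  move=> i; have [|q] := @rat_in_itvoo R (x 0 i - k.+1%:R^-1) (x 0 i + k.+1%:R^-1).
    by rewrite ltrD2l gt0_cp// invr_gt0.
  by rewrite in_itv/= => qx; exists q; rewrite ltr_distl.
exists (\row_i q i, k) => //.
rewrite ifT; first by move=> i; rewrite mxE.
apply/asboolP => y /= yq; apply: xeU; split => // i j.
rewrite ord1 -ball_normE/=.
rewrite (le_lt_trans (ler_distD (ratr (q j)) _ _))// [ltRHS]splitr.
apply: ltrD; first by rewrite distrC (lt_trans (qx j)).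
by have := yq j; rewrite mxE => /lt_trans; apply.
Qed.

Lemma open_continuous_measurable_rV (U : set 'rV[R]_n) (f : 'rV[R]_n -> R) :
  open U -> (forall x, U x -> {for x, continuous f}) -> measurable_fun U f.
Proof.
move=> oU cf; apply: (measurability _ (RGenOpens.measurableE R)) => //.
move=> _ [_ [b [c ->] <-]]; apply: open_measurable_rV.
rewrite openE => x [Ux Vfx].
have Vx : nbhs (f x) `]b, c[%classic by apply: open_nbhs_nbhs; split => //; exact: interval_open.
rewrite /interior; apply: filterI; last exact: (cf x Ux _ Vx).
exact: open_nbhs_nbhs.
Qed.

End open_measurable_rV.

(** * The triangular window and the Fejer kernel *)

Section triangle_window.
Context (R : realType).
Implicit Types (N z s x : R).
Local Notation leb := (@lebesgue_measure R).

Definition triangle N x : R := Num.max 0 (1 - `|x| / N).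

(** The Fourier transform of the triangle of half-width $N$, that is the Fejer
    kernel; it is nonnegative, which the transform of a sharp cut-off is not. *)
Definition fejer N z : R :=
  if z == 0 then N else 2 * (1 - cos (N * z)) / (N * z ^+ 2).

Lemma norm_sin_le x : `|sin x| <= `|x|.
Proof.
wlog x0 : x / 0 <= x => [H|].
  have [/H//|/ltW x0] := leP 0 x.
  by rewrite -normrN -sinN -(normrN x); apply: H; rewrite oppr_ge0.
rewrite (ger0_norm x0).
have [c _] : exists2 c, c \in `[0, x] & sin x - sin 0 = cos c * (x - 0).
  apply: (@MVT_segment R (@sin R) (@cos R)) => //.
  by apply: continuous_subspaceT => ?; exact: continuous_sin.
rewrite sin0 !subr0 => ->; rewrite normrM (ger0_norm x0) ler_piMl//; exact: cos_max.
Qed.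

Lemma triangle_ge0 N x : 0 <= triangle N x.
Proof. by rewrite /triangle le_max lexx. Qed.

Lemma triangle_eq0 N x : 0 < N -> N <= `|x| -> triangle N x = 0.
Proof.
by move=> N0 Nx; apply/max_idPl; rewrite subr_le0 ler_pdivlMr// mul1r.
Qed.

Lemma triangle_pos N x : 0 < N -> `|x| <= N -> triangle N x = 1 - `|x| / N.
Proof.
by move=> N0 Nx; apply/max_idPr; rewrite subr_ge0 ler_pdivrMr// mul1r.
Qed.

Lemma continuous_triangle N : continuous (triangle N).
Proof.
move=> x; apply: (@continuous_max _ _ (cst 0) (fun x : R => 1 - `|x| / N)).
  exact: cst_continuous.
apply: continuousB; first exact: cst_continuous.
by apply: continuousM; [exact: norm_continuous|exact: cst_continuous].
Qed.

Lemma measurable_triangle N : measurable_fun setT (triangle N).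
Proof. by apply: continuous_measurable_fun; exact: continuous_triangle. Qed.

Lemma triangle_nd x N M : 0 < N -> N <= M -> triangle N x <= triangle M x.
Proof.
move=> N0 NM; have M0 := lt_le_trans N0 NM; rewrite /triangle.
rewrite ge_max le_max lexx/= le_max; apply/orP; right.
by rewrite lerD2l lerN2 ler_wpM2l// lef_pV2// posrE.
Qed.

Lemma triangle_cvg x : triangle k.+1%:R x @[k --> \oo] --> (1 : R).
Proof.
pose g (y : R) := Num.max 0 (1 - `|x| * y).
have cg : continuous g.
  move=> y; apply: (@continuous_max _ _ (cst 0) (fun y : R => 1 - `|x| * y)).
    exact: cst_continuous.
  apply: continuousB; first exact: cst_continuous.
  by apply: continuousM; [exact: cst_continuous|by move=> ?; exact: cvg_id].
have g0 : g 0 = 1 by rewrite /g mulr0 subr0; apply/max_idPr.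
suff : g (harmonic k) @[k --> \oo] --> g 0 by rewrite g0.
by apply: continuous_cvg; [exact: cg|exact: cvg_harmonic].
Qed.

Lemma fejer_ge0 N z : 0 < N -> 0 <= fejer N z.
Proof.
move=> N0; rewrite /fejer; case: ifPn => _; first exact: ltW.
by rewrite divr_ge0// mulr_ge0// ?subr_ge0 ?cos_le1// ?sqr_ge0// ltW.
Qed.

Lemma oneB_cos_le x : 2 * (1 - cos x) <= x ^+ 2.
Proof.
have -> : 2 * (1 - cos x) = (2 * sin (x / 2)) ^+ 2.
  rewrite exprMn sin2cos2 {1}(_ : x = (x / 2) *+ 2); last by rewrite -mulr_natr; field.
  by rewrite cos_mulr2n; ring.
rewrite -[leLHS]real_normK ?num_real// -[leRHS]real_normK ?num_real//.
rewrite lerXn2r ?nnegrE// normrM (ger0_norm (_ : 0 <= 2))//.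
have := norm_sin_le (x / 2); rewrite normrM (ger0_norm (_ : 0 <= 2^-1)); lra.
Qed.

(** The sum of the two trivial bounds $N$ (the mass of the window) and
    $4/(Nz^2)$, in a form whose integral is an arctangent. *)
Lemma fejer_le N z : 0 < N -> fejer N z <= 5 * (oneDsqr (N * z))^-1 * N.
Proof.
move=> N0; rewrite /fejer /oneDsqr; case: eqVneq => [->|z0].
  rewrite mulr0 expr0n/= addr0 invr1 mulr1; lra.
have Nz : 0 < (N * z) ^+ 2 by rewrite exprn_even_gt0//= mulf_neq0// gt_eqF.
have -> : 2 * (1 - cos (N * z)) / (N * z ^+ 2) =
   (2 * (1 - cos (N * z))) / (N * z) ^+ 2 * N.
  by field; rewrite z0 gt_eqF.
rewrite ler_pM2r// ler_pdivlMr ?addr_gt0// mulrAC ler_pdivrMr//.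
(* With $q=(Nz)^2$ and $y=2(1-\cos Nz)$, one has $y\le q$ and $y\le4$, so that
   $y(1+q)\le q+4q$. *)
have := oneB_cos_le (N * z); have := cos_geN1 (N * z).
have := cos_le1 (N * z).
set c := cos _; set q := (N * z) ^+ 2 in Nz *; nra.
Qed.

Lemma integral_triangleE N (h : R -> R) : 0 < N -> continuous h ->
  (\int[leb]_x (triangle N x * h x)%:E =
   \int[leb]_(x in `[(- N)%R, 0%R]) ((1 + x / N) * h x)%:E +
   \int[leb]_(x in `[0%R, N]) ((1 - x / N) * h x)%:E)%E.
Proof.
move=> N0 ch.
have mt : measurable_fun setT (fun x => (triangle N x * h x)%:E).
  apply/measurable_EFinP; apply: measurable_funM; first exact: measurable_triangle.
  exact: continuous_measurable_fun.
have -> : (\int[leb]_x (triangle N x * h x)%:E =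
    \int[leb]_(x in `[(- N)%R, N]) (triangle N x * h x)%:E)%E.
  rewrite [RHS]integral_mkcond; apply: eq_integral => x _.
  rewrite patchE; case: ifPn => //; rewrite notin_setE/= in_itv/= -ler_norml.
  by move=> /negP; rewrite -ltNge => /ltW /(triangle_eq0 N0) ->; rewrite mul0r.
have -> : `[(- N), N]%classic = `[(- N), 0[%classic `|` `[0%R, N]%classic :> set R.
  rewrite -itv_bndbnd_setU// bnd_simp; [by rewrite oppr_le0 ltW|exact: ltW].
rewrite integral_setU//; last 2 first.
- exact: measurable_funTS.
- by apply/disj_setPS => x []/=; rewrite !in_itv/= => /andP[_ +] /andP[+ _]; rewrite ltNge => /negP.
rewrite integral_itv_bndo_bndc; last exact: measurable_funTS.
congr (_ + _)%E; apply: eq_integral => x; rewrite inE/= in_itv/= => /andP[x1 x2].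
  rewrite triangle_pos//; last by rewrite ler0_norm// lerNl.
  by rewrite ler0_norm// mulNr opprK.
by rewrite triangle_pos// ger0_norm.
Qed.

Lemma continuous_FTC2T (f F : R -> R) a b : a < b -> continuous f ->
  (forall x, is_derive x 1 F (f x)) ->
  (\int[leb]_(x in `[a, b]) (f x)%:E = (F b - F a)%:E)%E.
Proof.
move=> ab cf dF.
have cF : continuous F.
  by move=> x; apply/differentiable_continuous/derivable1_diffP; exact: ex_derive.
rewrite (continuous_FTC2 ab (F := F)) ?EFinB//.
- exact: continuous_subspaceT.
- split => [x _||]; first exact: ex_derive.
    by apply: cvg_at_right_filter; exact: cF.
  by apply: cvg_at_left_filter; exact: cF.
- by move=> x _; rewrite derive1E; exact: derive_val.
Qed.

Let scaleRE (a b : R) : a *: b = a * b. Proof. by []. Qed.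

Definition affine (p q x : R) : R := p + q * x.

Lemma is_derive_affine p q x : is_derive x 1 (affine p q) q.
Proof.
have -> : affine p q = cst p + (q \*: id) by [].
by apply: is_derive_eq; rewrite add0r scaler1.
Qed.

Lemma continuous_affine p q : continuous (affine p q).
Proof.
move=> x; apply/differentiable_continuous/derivable1_diffP.
have d := is_derive_affine p q x; exact: ex_derive.
Qed.

(** The primitive comes from one integration by parts. *)
Lemma integral_affine_cos p q z s a b : a < b -> z != 0 ->
  let G := fun x => affine p q x * (sin (affine s z x) / z) +
                    q / z ^+ 2 * cos (affine s z x) in
  (\int[leb]_(x in `[a, b]) (affine p q x * cos (affine s z x))%:E =
   (G b - G a)%:E)%E.
Proof.
move=> ab z0 G; apply: continuous_FTC2T => //.
  move=> x; apply: (@continuousM _ _ (affine p q) (cos \o affine s z)).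
    exact: continuous_affine.
  by apply: continuous_comp; [exact: continuous_affine|exact: continuous_cos].
move=> x.
have -> : G = affine p q * (z^-1 \*: (sin \o affine s z)) +
    ((q / z ^+ 2) \*: (cos \o affine s z)).
  by apply/funext => y; rewrite /G !fctE /= !scaleRE [z^-1 * _]mulrC.
have d1 := is_derive_affine p q x; have d2 := is_derive_affine s z x.
apply: is_derive_eq; rewrite !fctE /= !scaleRE; field.
exact: z0.
Qed.

(** The phase $s$ is there for the induction on the dimension: the other
    coordinates of a scalar product enter the cosine as a phase. The sine terms
    of the two halves of the window cancel. *)
Lemma integral_triangle_cos N z s : 0 < N ->
  (\int[leb]_x (triangle N x * cos (x * z + s))%:E = (cos s * fejer N z)%:E)%E.
Proof.
move=> N0.
have ccos : continuous (cos \o affine s z).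
  by move=> x; apply: continuous_comp; [exact: continuous_affine|exact: continuous_cos].
have -> : (fun x => (triangle N x * cos (x * z + s))%:E) =
          (fun x => (triangle N x * (cos \o affine s z) x)%:E).
  by apply/funext => x /=; rewrite /affine addrC mulrC [z * x]mulrC mulrC.
rewrite integral_triangleE// /fejer; case: eqVneq => [->|z0].
- have E c a b : a < b -> (\int[leb]_(x in `[a, b]) ((1 + c * x) * cos (affine s 0 x))%:E =
    (cos s * ((b + c * b ^+ 2 / 2) - (a + c * a ^+ 2 / 2)))%:E)%E.
    move=> ab.
    pose F := cos s \*: (id + (c / 2) \*: (id * id)) : R -> R.
    have dF x : is_derive x 1 F (affine 1 c x * cos (affine s 0 x)).
      apply: is_derive_eq.
      by rewrite /= /affine mul0r addr0 !scaleRE; field.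
    rewrite (continuous_FTC2T ab _ dF).
      by congr EFin; rewrite /F !fctE /= !scaleRE; field.
    move=> x; apply: (@continuousM _ _ (affine 1 c) (cos \o affine s 0)).
      exact: continuous_affine.
    by apply: continuous_comp; [exact: continuous_affine|exact: continuous_cos].
  under eq_integral do rewrite [_ / N]mulrC.
  rewrite E ?oppr_lt0//.
  under [X in (_ + X)%E]eq_integral do rewrite [_ / N]mulrC -mulNr.
  rewrite E// -EFinD; congr EFin; field; exact: lt0r_neq0.
- under eq_integral do rewrite [_ / N]mulrC -/(affine _ _ _).
  rewrite integral_affine_cos ?oppr_lt0//.
  under [X in (_ + X)%E]eq_integral do rewrite [_ / N]mulrC -mulNr -/(affine _ _ _).
  rewrite integral_affine_cos// -EFinD; congr EFin.
  rewrite /affine !mulr0 !addr0 (mulrN z) !cosD !sinD !sinN !cosN [z * N]mulrC.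
  by field; rewrite z0 lt0r_neq0.
Qed.

Lemma integral_oneDsqrV : (\int[leb]_x ((oneDsqr x)^-1)%:E = pi%:E)%E.
Proof.
rewrite ge0_symfun_integralT//.
- rewrite -set_itvcy integral0y_oneDsqr -EFinM; congr EFin; by field.
- exact: continuous_oneDsqrV.
- by move=> x /=; rewrite /oneDsqr sqrrN.
Qed.

Lemma integral_triangle N : 0 < N -> (\int[leb]_x (triangle N x)%:E = N%:E)%E.
Proof.
move=> N0; have := @integral_triangle_cos N 0 0 N0.
under eq_integral do rewrite mulr0 addr0 cos0 mulr1.
by move=> ->; rewrite /fejer eqxx cos0 mul1r.
Qed.

Lemma integrable_triangle_cos N z s : 0 < N ->
  leb.-integrable setT (fun x => (triangle N x * cos (x * z + s))%:E).
Proof.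
move=> N0.
have it : leb.-integrable setT (EFin \o triangle N).
  apply/integrableP; split; first by apply/measurable_EFinP; exact: measurable_triangle.
  under eq_integral do rewrite /= ger0_norm ?triangle_ge0//.
  by rewrite integral_triangle// ltry.
apply: le_integrable it => //.
  apply/measurable_EFinP; apply: measurable_funM; first exact: measurable_triangle.
  apply: (measurableT_comp (continuous_measurable_fun (@continuous_cos R))).
  apply: measurable_funD; last exact: measurable_cst.
  by apply: measurable_funM; [exact: measurable_id|exact: measurable_cst].
move=> x _; rewrite /= lee_fin normrM (ger0_norm (triangle_ge0 _ _)).
by rewrite ler_piMr ?triangle_ge0// cos_max.
Qed.

(** The kernel is a parametric integral of the window, which avoids a case
    analysis on its removable singularity. *)
Lemma measurable_fejer N : 0 < N -> measurable_fun setT (fejer N).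
Proof.
move=> N0.
have -> : fejer N = fun z => \int[leb]_x (triangle N x * cos (x * z + 0)).
  by apply/funext => z; rewrite /Rintegral integral_triangle_cos//= cos0 mul1r.
apply: (@measurable_parametric_Rintegral _ _ _ _ _ leb
  (fun p : R * R => triangle N p.2 * cos (p.2 * p.1 + 0))).
apply: measurable_funM.
  exact: (measurableT_comp (measurable_triangle N) measurable_snd).
apply: (measurableT_comp (continuous_measurable_fun (@continuous_cos R))).
apply: measurable_funD; last exact: measurable_cst.
by apply: measurable_funM; [exact: measurable_snd|exact: measurable_fst].
Qed.

(** The bound does not depend on $N$: by scaling, the majorant
    $5N/(1+N^2z^2)$ has integral $5\pi$. *)
Lemma integral_fejer_le N a : 0 < N ->
  (\int[leb]_y (fejer N (a - y))%:E <= (5 * pi)%:E)%E.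
Proof.
move=> N0.
have dF x := is_derive_affine (- (N * a)) N x.
have F'E : derive1 (affine (- (N * a)) N) = cst N.
  by apply/funext => x; rewrite derive1E; exact: derive_val.
have cq : continuous (fun x => 5 * (oneDsqr x)^-1 : R).
  move=> x; apply: (@continuousM _ _ (cst 5) (fun x => (oneDsqr x)^-1)).
    exact: cst_continuous.
  exact: continuous_oneDsqrV.
pose q y : R := 5 * (oneDsqr (affine (- (N * a)) N y))^-1 * N.
have mq : measurable_fun setT q.
  apply: continuous_measurable_fun => y.
  apply: (@continuousM _ _ ((fun x => 5 * (oneDsqr x)^-1) \o affine (- (N * a)) N) (cst N)).
    by apply: continuous_comp; [exact: continuous_affine|exact: cq].
  exact: cst_continuous.
apply: (@le_trans _ _ (\int[leb]_y (q y)%:E)%E).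
  apply: ge0_le_integral => //.
  - by move=> x _; rewrite lee_fin fejer_ge0.
  - apply/measurable_EFinP; apply: (measurableT_comp (measurable_fejer N0)).
    by apply: measurable_funB; [exact: measurable_cst|exact: measurable_id].
  - exact/measurable_EFinP.
  - move=> x _; rewrite lee_fin (le_trans (fejer_le _ N0))// /q /oneDsqr /affine.
    by rewrite -[in leRHS]sqrrN opprD opprK -mulrBr.
have -> : (\int[leb]_y (q y)%:E = \int[leb]_x (5 * (oneDsqr x)^-1)%:E)%E.
  rewrite (@increasing_ge0_integration_by_substitutionT R
    (affine (- (N * a)) N) (fun x => 5 * (oneDsqr x)^-1)).
  - by rewrite F'E.
  - by move=> x y xy; rewrite ltrD2l ltr_pM2l.
  - by rewrite F'E; exact: cst_continuous.
  - by rewrite F'E; exact: is_cvg_cst.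
  - by rewrite F'E; exact: is_cvg_cst.
  - by move=> x; exact: ex_derive.
  - apply/cvgrNyPle => A.
    apply: filterS (nbhs_ninfty_le (num_real ((A + N * a) / N))) => x.
    by rewrite ler_pdivlMr// /affine => ?; lra.
  - apply/cvgryPge => A.
    apply: filterS (nbhs_pinfty_ge (num_real ((A + N * a) / N))) => x.
    by rewrite ler_pdivrMr// /affine => ?; lra.
  - exact: cq.
  - by move=> x; rewrite mulr_ge0// invr_ge0 (le_trans _ (oneDsqr_ge1 x)).
under eq_integral do rewrite EFinM.
rewrite ge0_integralZl//; last first.
  apply/measurable_EFinP; apply: continuous_measurable_fun.
  exact: continuous_oneDsqrV.
by rewrite integral_oneDsqrV.
Qed.

End triangle_window.

(** * Product windows in n dimensions *)

Section product_sigma_finite.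
Context d1 d2 (T1 : measurableType d1) (T2 : measurableType d2) (R : realType).
Variable m1 : {sigma_finite_measure set T1 -> \bar R}.
Variable m2 : {sigma_finite_measure set T2 -> \bar R}.

Let sigma_finite_product : sigma_finite setT (m1 \x m2)%E.
Proof.
have [F UF Ffin] := sigma_finiteT m1; have [G UG Gfin] := sigma_finiteT m2.
exists (fun k => if (unpickle k : option (nat * nat)) is Some ij
                 then F ij.1 `*` G ij.2 else set0).
  apply/esym/seteqP; split => // -[x y] _.
  have [i _ Fx] : (\bigcup_i F i) x by rewrite -UF.
  have [j _ Gy] : (\bigcup_i G i) y by rewrite -UG.
  by exists (pickle (i, j)) => //; rewrite pickleK.
move=> k; case: (unpickle k) => [[i j]|]; last by rewrite measure0.
have [mF Foo] := Ffin i; have [mG Goo] := Gfin j; split; first exact: measurableX.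
by rewrite /= product_measure1E// lte_mul_pinfty// ge0_fin_numE.
Qed.

(** The product measure, packed as a sigma-finite measure so that it can itself
    be a factor of a product. *)
Definition sigma_finite_tensor : {sigma_finite_measure set (T1 * T2)%type -> \bar R} :=
  HB.pack (m1 \x m2)%E
    (Measure_isSigmaFinite.Build _ _ _ (m1 \x m2)%E sigma_finite_product).

End product_sigma_finite.

Section product_integrals.
Context d1 d2 (T1 : measurableType d1) (T2 : measurableType d2) (R : realType).
Variable m1 : {sigma_finite_measure set T1 -> \bar R}.
Variable m2 : {sigma_finite_measure set T2 -> \bar R}.
Variables (f : T1 -> R) (g : T2 -> R).
Hypothesis intf : m1.-integrable setT (EFin \o f).
Hypothesis intg : m2.-integrable setT (EFin \o g).

Let mf : measurable_fun setT f.
Proof. by apply/measurable_EFinP; exact: measurable_int intf. Qed.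

Let mg : measurable_fun setT g.
Proof. by apply/measurable_EFinP; exact: measurable_int intg. Qed.

Lemma integrable_tensor :
  (m1 \x m2)%E.-integrable setT (fun p : T1 * T2 => (f p.1 * g p.2)%:E).
Proof.
apply/integrable12ltyP.
  apply/measurable_EFinP; apply: measurable_funM.
    exact: (measurableT_comp mf measurable_fst).
  exact: (measurableT_comp mg measurable_snd).
under eq_integral => x _.
  under eq_integral do rewrite /= normrM EFinM.
  rewrite ge0_integralZl//; last first.
    by apply/measurable_EFinP; exact: measurableT_comp.
  over.
have [G0 Gfin] : (0 <= \int[m2]_y `|g y|%:E)%E /\ (\int[m2]_y `|g y|%:E < +oo)%E.
  split; first exact: integral_ge0.
  by have /integrableP[] := intg.
rewrite ge0_integralZr//.
  rewrite lte_mul_pinfty// ?integral_ge0 ?ge0_fin_numE ?integral_ge0//.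
  by have /integrableP[] := intf.
by apply/measurable_EFinP; exact: measurableT_comp.
Qed.

Lemma integral_tensor :
  (\int[m1 \x m2]_p (f p.1 * g p.2)%:E =
   ((\int[m1]_x f x) * (\int[m2]_y g y))%:E)%E.
Proof.
have Ef : (\int[m1]_x (f x)%:E = (\int[m1]_x f x)%:E)%E.
  by rewrite /Rintegral fineK//; exact: integrable_fin_num.
have Eg : (\int[m2]_x (g x)%:E = (\int[m2]_x g x)%:E)%E.
  by rewrite /Rintegral fineK//; exact: integrable_fin_num.
rewrite -(integral12_prod_meas1 integrable_tensor) /fubini_F /=.
under eq_integral => x _.
  under eq_integral do rewrite EFinM.
  rewrite integralZl// Eg.
  over.
by rewrite integralZr// Ef.
Qed.

End product_integrals.

Section product_functions_rV.
Context (R : realType).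
Local Notation leb := (@lebesgue_measure R).

Lemma measurable_prod_rV n (g : 'I_n -> R -> R) :
  (forall i, measurable_fun setT (g i)) ->
  measurable_fun setT (fun x : 'rV[R]_n => \prod_i g i (x 0 i)).
Proof.
move=> mg; apply: measurable_prod => i _.
exact: (measurableT_comp (mg i) (measurable_coord_rV i)).
Qed.

Lemma integral_prod_rV_le n (g : 'I_n -> R -> R) (K : R) :
  (forall i, measurable_fun setT (g i)) -> (forall i t, 0 <= g i t) ->
  (forall i, (\int[leb]_t (g i t)%:E <= K%:E)%E) ->
  (\int[lebesgue_rV R n]_x (\prod_i g i (x 0 i))%:E <= (K ^+ n)%:E)%E.
Proof.
elim: n g => [|n IH] g mg g0 gK.
  rewrite [leLHS](_ : _ = \int[\d_ (0%R : 'rV[R]_0)]_x 1)%E; last first.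
    by apply: eq_integral => x _; rewrite big_ord0.
  by rewrite integral_dirac// diracT mule1.
have K0 : 0 <= K.
  by rewrite -lee_fin (le_trans _ (gK ord0))// integral_ge0// => t _; rewrite lee_fin.
rewrite ge0_integral_lebesgue_rVS; first last.
- by move=> x; rewrite lee_fin prodr_ge0.
- by apply/measurable_EFinP; exact: measurable_prod_rV.
pose h (v : 'rV[R]_n) := \prod_i g (lift ord0 i) (v 0 i).
have mh : measurable_fun setT h.
  exact: (@measurable_prod_rV n (fun i => g (lift ord0 i))).
have -> : (\int[leb]_a \int[lebesgue_rV R n]_v (\prod_i g i (cons_rV (a, v) 0 i))%:E =
    \int[leb]_a ((g ord0 a)%:E * \int[lebesgue_rV R n]_v (h v)%:E))%E.
  apply: eq_integral => a _; rewrite -ge0_integralZl//; last 3 first.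
  - exact/measurable_EFinP.
  - by move=> v _; rewrite lee_fin prodr_ge0.
  - by rewrite lee_fin.
  apply: eq_integral => v _; rewrite big_ord_recl cons_rV0 -EFinM; congr (_ * _)%:E.
  by apply: eq_bigr => i _; rewrite cons_rV_lift.
rewrite ge0_integralZr//; last 3 first.
- by apply/measurable_EFinP; exact: mg.
- by move=> t _; rewrite lee_fin.
- by apply: integral_ge0 => v _; rewrite lee_fin prodr_ge0.
rewrite exprS EFinM lee_pmul//; last by apply: (IH (fun i => g (lift ord0 i))).
- by apply: integral_ge0 => t _; rewrite lee_fin.
- by apply: integral_ge0 => v _; rewrite lee_fin prodr_ge0.
Qed.

End product_functions_rV.

Section fejer_window.
Context (R : realType).
Local Notation leb := (@lebesgue_measure R).

Definition window n (N : R) (x : 'rV[R]_n) : R := \prod_i triangle N (x 0 i).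

Lemma measurable_window n N : measurable_fun setT (@window n N).
Proof.
by apply: (@measurable_prod_rV _ _ (fun=> triangle N)) => i; exact: measurable_triangle.
Qed.

Lemma window_ge0 n N (x : 'rV[R]_n) : 0 <= window N x.
Proof. by rewrite prodr_ge0// => i _; exact: triangle_ge0. Qed.

Lemma window_cons n N a (v : 'rV[R]_n) :
  window N (cons_rV (a, v)) = triangle N a * window N v.
Proof.
rewrite /window big_ord_recl cons_rV0; congr (_ * _).
by apply: eq_bigr => i _; rewrite cons_rV_lift.
Qed.

Lemma integrable_window n N : 0 < N ->
  (lebesgue_rV R n).-integrable setT (EFin \o @window n N).
Proof.
move=> N0; apply/integrableP; split; first by apply/measurable_EFinP; exact: measurable_window.
under eq_integral do rewrite /= ger0_norm ?window_ge0//.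
apply: (@le_lt_trans _ _ (N ^+ n)%:E); last exact: ltry.
apply: (@integral_prod_rV_le _ _ (fun=> triangle N)) => [_|_|_].
- exact: measurable_triangle.
- exact: triangle_ge0.
- by rewrite integral_triangle.
Qed.

Lemma measurable_cos_dotp n (z : 'rV[R]_n) s :
  measurable_fun setT (fun x => cos (dotp x z + s)).
Proof.
apply: (measurableT_comp (continuous_measurable_fun (@continuous_cos R))).
apply: measurable_funD; last exact: measurable_cst.
by under eq_fun do rewrite dotpC; exact: measurable_dotpr.
Qed.

Lemma integrable_window_cos n N (z : 'rV[R]_n) s : 0 < N ->
  (lebesgue_rV R n).-integrable setT (fun x => (window N x * cos (dotp x z + s))%:E).
Proof.
move=> N0; apply: le_integrable (integrable_window n N0) => //.
  apply/measurable_EFinP; apply: measurable_funM; first exact: measurable_window.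
  exact: measurable_cos_dotp.
by move=> x _; rewrite /= lee_fin normrM ler_piMr// cos_max.
Qed.

(** The first coordinate is integrated last, the others contributing the value
    at the phase shifted by its share of the scalar product. *)
Lemma integral_window_cos n N (z : 'rV[R]_n) s : 0 < N ->
  (\int[lebesgue_rV R n]_x (window N x * cos (dotp x z + s))%:E =
   (cos s * \prod_i fejer N (z 0 i))%:E)%E.
Proof.
move=> N0; elim: n z s => [|n IH] z s.
  rewrite [LHS](_ : _ = \int[\d_ (0%R : 'rV[R]_0)]_x (cos s)%:E)%E; last first.
    by apply: eq_integral => x _; rewrite /window /dotp !big_ord0 mul1r add0r.
  by rewrite integral_dirac// diracT mul1e big_ord0 mulr1.
rewrite integral_lebesgue_rVS; last exact: integrable_window_cos.
pose z' := (\row_j z 0 (lift ord0 j)) : 'rV[R]_n.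
pose F := \prod_i fejer N (z' 0 i).
transitivity (\int[leb]_a ((triangle N a * cos (a * z 0 ord0 + s))%:E * F%:E))%E.
  apply: eq_integral => a _.
  transitivity (\int[lebesgue_rV R n]_v ((triangle N a)%:E *
      (window N v * cos (dotp v z' + (a * z 0 ord0 + s)))%:E))%E.
    apply: eq_integral => v _; rewrite dotp_cons -EFinM window_cons -mulrA.
    by rewrite -addrA addrCA.
  rewrite integralZl//; last exact: integrable_window_cos.
  by rewrite IH -!EFinM mulrA.
rewrite integralZr//; last exact: integrable_triangle_cos.
rewrite integral_triangle_cos// -EFinM big_ord_recl mulrA; congr (_ * _)%:E.
by apply: eq_bigr => i _; rewrite mxE.
Qed.

Lemma integral_fejer_translate_le n N (z : 'rV[R]_n) : 0 < N ->
  (\int[lebesgue_rV R n]_y (\prod_i fejer N ((z - y) 0 i))%:E <= ((5 * pi) ^+ n)%:E)%E.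
Proof.
move=> N0; under eq_integral => y _ do under eq_bigr do rewrite !mxE.
apply: (@integral_prod_rV_le _ _ (fun i y => fejer N (z 0 i - y))) => [i|i t|i].
- apply: (measurableT_comp (measurable_fejer N0)).
  by apply: measurable_funB; [exact: measurable_cst|exact: measurable_id].
- exact: fejer_ge0.
- exact: integral_fejer_le.
Qed.

End fejer_window.

(** * Plancherel's inequality *)

Section plancherel.
Context (R : realType) (n : nat).
Local Notation mu := (lebesgue_rV R n).
Implicit Types (A : 'rV[R]_n -> R).

Definition cos_transform A x : R := \int[mu]_z (cos (dotp x z) * A z).
Definition sin_transform A x : R := \int[mu]_z (sin (dotp x z) * A z).

Lemma measurable_cos_transform A : measurable_fun setT A ->
  measurable_fun setT (cos_transform A).
Proof.
move=> mA; apply: (@measurable_parametric_Rintegral _ _ _ _ _ mu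
  (fun p : 'rV[R]_n * 'rV[R]_n => cos (dotp p.1 p.2) * A p.2)).
apply: measurable_funM; last exact: (measurableT_comp mA measurable_snd).
exact: (measurableT_comp (continuous_measurable_fun (@continuous_cos R)) (@measurable_dotp R n)).
Qed.

Lemma measurable_sin_transform A : measurable_fun setT A ->
  measurable_fun setT (sin_transform A).
Proof.
move=> mA; apply: (@measurable_parametric_Rintegral _ _ _ _ _ mu
  (fun p : 'rV[R]_n * 'rV[R]_n => sin (dotp p.1 p.2) * A p.2)).
apply: measurable_funM; last exact: (measurableT_comp mA measurable_snd).
exact: (measurableT_comp (continuous_measurable_fun (@continuous_sin R)) (@measurable_dotp R n)).
Qed.

Lemma integrable_bounded_mul (g A : 'rV[R]_n -> R) :
  measurable_fun setT g -> (forall z, `|g z| <= 1) ->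
  mu.-integrable setT (EFin \o A) ->
  mu.-integrable setT (EFin \o (fun z => g z * A z)).
Proof.
move=> mg g1 iA; apply: le_integrable (iA) => //.
  apply/measurable_EFinP; apply: measurable_funM => //.
  by apply/measurable_EFinP; exact: measurable_int iA.
by move=> z _; rewrite /= lee_fin normrM ler_piMl.
Qed.

Lemma integrable_cos_mul A x : mu.-integrable setT (EFin \o A) ->
  mu.-integrable setT (EFin \o (fun z => cos (dotp x z) * A z)).
Proof.
apply: integrable_bounded_mul => [|z]; last exact: cos_max.
exact: (measurableT_comp (continuous_measurable_fun (@continuous_cos R)) (@measurable_dotpr R n x)).
Qed.

Lemma integrable_sin_mul A x : mu.-integrable setT (EFin \o A) ->
  mu.-integrable setT (EFin \o (fun z => sin (dotp x z) * A z)).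
Proof.
apply: integrable_bounded_mul => [|z]; last exact: sin_max.
exact: (measurableT_comp (continuous_measurable_fun (@continuous_sin R)) (@measurable_dotpr R n x)).
Qed.

(** The square of the modulus of the Fourier transform is a double integral:
    $\cos(x\cdot y)\cos(x\cdot z)+\sin(x\cdot y)\sin(x\cdot z)
      =\cos(x\cdot(y-z))$. *)
Lemma transform_energyE A x : mu.-integrable setT (EFin \o A) ->
  ((cos_transform A x ^+ 2 + sin_transform A x ^+ 2)%:E =
   \int[mu \x mu]_p (cos (dotp x (p.1 - p.2)) * (A p.1 * A p.2))%:E)%E.
Proof.
move=> iA.
have ic := integrable_cos_mul x iA; have is' := integrable_sin_mul x iA.
rewrite EFinD !expr2 -(integral_tensor ic ic) -(integral_tensor is' is').
rewrite -integralD//; [|exact: (integrable_tensor ic ic)|exact: (integrable_tensor is' is')].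
apply: eq_integral => p _; rewrite -EFinD dotpBr cosB; congr EFin.
by ring.
Qed.

Lemma fejerN N z : fejer N (- z) = fejer N z :> R.
Proof. by rewrite /fejer oppr_eq0 mulrN cosN sqrrN. Qed.

Let fejer_prod N (p : 'rV[R]_n * 'rV[R]_n) : R := \prod_i fejer N ((p.1 - p.2) 0 i).

Let fejer_prod_ge0 N p : 0 < N -> 0 <= fejer_prod N p.
Proof. by move=> N0; rewrite prodr_ge0// => i _; exact: fejer_ge0. Qed.

Let fejer_prodC N x y : fejer_prod N (x, y) = fejer_prod N (y, x).
Proof.
by apply: eq_bigr => i _; rewrite /= -fejerN; congr fejer; rewrite !mxE opprB.
Qed.

Let measurable_fejer_prod N : 0 < N -> measurable_fun setT (fejer_prod N).
Proof.
move=> N0; apply: measurable_prod => i _.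
under eq_fun do rewrite !mxE.
apply: (measurableT_comp (measurable_fejer N0)).
apply: measurable_funB.
  exact: (measurableT_comp (measurable_coord_rV i) measurable_fst).
exact: (measurableT_comp (measurable_coord_rV i) measurable_snd).
Qed.

(** One half of the Schur test: the row integrals of the kernel are bounded. *)
Let half_energy_le N (B : 'rV[R]_n -> R) : 0 < N ->
  measurable_fun setT B -> (forall z, 0 <= B z) ->
  (\int[mu]_x \int[mu]_y (B x / 2 * fejer_prod N (x, y))%:E <=
   ((5 * pi) ^+ n / 2)%:E * \int[mu]_z (B z)%:E)%E.
Proof.
move=> N0 mB B0.
have mP x : measurable_fun setT (fun y => fejer_prod N (x, y)).
  apply: (measurableT_comp (measurable_fejer_prod N0)).
  by apply: measurable_fun_pair; [exact: measurable_cst|exact: measurable_id].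
rewrite -ge0_integralZl//; last 3 first.
- exact/measurable_EFinP.
- by move=> z _; rewrite lee_fin.
- by rewrite lee_fin divr_ge0// exprn_ge0// mulr_ge0// pi_ge0.
apply: ge0_le_integral => //.
- by move=> x _; apply: integral_ge0 => y _; rewrite lee_fin mulr_ge0 ?fejer_prod_ge0// divr_ge0.
- apply: (@measurable_parametric_integral _ _ _ _ _ mu
    (fun p : 'rV[R]_n * 'rV[R]_n => (B p.1 / 2 * fejer_prod N (p.1, p.2))%:E)).
  apply/measurable_EFinP; apply: measurable_funM.
    apply: measurable_funM; last exact: measurable_cst.
    exact: (measurableT_comp mB measurable_fst).
  by under eq_fun do rewrite -surjective_pairing; exact: measurable_fejer_prod.
- by apply/measurable_EFinP; apply: measurable_funM => //; exact: measurable_cst.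
move=> x _.
under eq_integral do rewrite EFinM.
rewrite ge0_integralZl//; last 3 first.
- exact/measurable_EFinP.
- by move=> y _; rewrite lee_fin fejer_prod_ge0.
- by rewrite lee_fin divr_ge0.
apply: (@le_trans _ _ ((B x / 2)%:E * ((5 * pi) ^+ n)%:E)%E).
  by rewrite lee_wpmul2l ?integral_fejer_translate_le// lee_fin divr_ge0.
by rewrite -!EFinM lee_fin; lra.
Qed.

(** Plancherel's inequality in front of a window. The window makes the triple
    integral absolutely convergent, so that the position $x$ can be integrated
    first; this produces the Fejer kernel at the difference of the two
    frequencies. As the kernel is nonnegative with bounded integral,
    $|A(y)A(z)|\le(A(y)^2+A(z)^2)/2$ concludes (Schur's test). *)
Lemma integral_window_energy_le A N : 0 < N -> mu.-integrable setT (EFin \o A) ->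
  (\int[mu]_x (window N x * (cos_transform A x ^+ 2 + sin_transform A x ^+ 2))%:E <=
   ((5 * pi) ^+ n)%:E * \int[mu]_z (A z ^+ 2)%:E)%E.
Proof.
move=> N0 iA.
have mA : measurable_fun setT A by apply/measurable_EFinP; exact: measurable_int iA.
have mA2 : measurable_fun setT (fun z => A z ^+ 2) by exact: measurable_funX.
pose AA (p : 'rV[R]_n * 'rV[R]_n) := A p.1 * A p.2.
pose mu2 := sigma_finite_tensor mu mu.
have iAA : mu2.-integrable setT (EFin \o AA) := integrable_tensor iA iA.
pose h (q : 'rV[R]_n * ('rV[R]_n * 'rV[R]_n)) : R :=
  window N q.1 * (cos (dotp q.1 (q.2.1 - q.2.2)) * (A q.2.1 * A q.2.2)).
have m1 : measurable_fun setT (fun q : 'rV[R]_n * ('rV[R]_n * 'rV[R]_n) => q.2.1).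
  exact: (measurableT_comp measurable_fst measurable_snd).
have m2 : measurable_fun setT (fun q : 'rV[R]_n * ('rV[R]_n * 'rV[R]_n) => q.2.2).
  exact: (measurableT_comp measurable_snd measurable_snd).
have mh : measurable_fun setT h.
  apply: measurable_funM.
    exact: (measurableT_comp (@measurable_window R n N) measurable_fst).
  apply: measurable_funM; last first.
    by apply: measurable_funM; [exact: (measurableT_comp mA m1)|exact: (measurableT_comp mA m2)].
  under eq_fun do rewrite dotpBr.
  apply: (measurableT_comp (continuous_measurable_fun (@continuous_cos R))).
  apply: measurable_funB.
    exact: (measurableT_comp (@measurable_dotp R n) (measurable_fun_pair measurable_fst m1)).
  exact: (measurableT_comp (@measurable_dotp R n) (measurable_fun_pair measurable_fst m2)).
have ih : (mu \x mu2)%E.-integrable setT (EFin \o h).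
  have iw := integrable_tensor (integrable_window n N0) iAA.
  apply: le_integrable iw => //; first exact/measurable_EFinP.
  move=> q _; rewrite /= lee_fin /h normrM [leRHS]normrM ler_wpM2l// normrM.
  by rewrite ler_piMl// cos_max.
have -> : (\int[mu]_x (window N x * (cos_transform A x ^+ 2 + sin_transform A x ^+ 2))%:E =
    \int[mu]_x \int[mu2]_p (h (x, p))%:E)%E.
  apply: eq_integral => x _; rewrite EFinM transform_energyE// -integralZl//.
  apply: le_integrable (iAA) => //.
    apply/measurable_EFinP; apply: measurable_funM; last first.
      by apply/measurable_EFinP; exact: measurable_int iAA.
    apply: (measurableT_comp (continuous_measurable_fun (@continuous_cos R))).
    under eq_fun do rewrite dotpBr.
    apply: measurable_funB.
      exact: (measurableT_comp (@measurable_dotpr R n x) measurable_fst).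
    exact: (measurableT_comp (@measurable_dotpr R n x) measurable_snd).
  by move=> p _; rewrite /= lee_fin normrM ler_piMl// cos_max.
rewrite (Fubini ih).
have -> : (\int[mu2]_p \int[mu]_x (EFin \o h) (x, p) =
    \int[mu2]_p (A p.1 * A p.2 * fejer_prod N p)%:E)%E.
  apply: eq_integral => p _.
  transitivity (\int[mu]_x ((A p.1 * A p.2)%:E *
      (window N x * cos (dotp x (p.1 - p.2) + 0))%:E))%E.
    by apply: eq_integral => x _; rewrite /= -EFinM addr0 /h/=; congr EFin; ring.
  rewrite integralZl//; last exact: integrable_window_cos.
  by rewrite integral_window_cos// cos0 mul1r -EFinM.
have mP := measurable_fejer_prod N0.
pose B i (p : 'rV[R]_n * 'rV[R]_n) : R := A (if i then p.1 else p.2) ^+ 2 / 2 * fejer_prod N p.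
have mB i : measurable_fun setT (B i).
  apply: measurable_funM => //; apply: measurable_funM; last exact: measurable_cst.
  by case: i; [exact: (measurableT_comp mA2 measurable_fst)|
               exact: (measurableT_comp mA2 measurable_snd)].
have B0 i p : 0 <= B i p by rewrite mulr_ge0 ?fejer_prod_ge0// divr_ge0// sqr_ge0.
have mAAP : measurable_fun setT (fun p => A p.1 * A p.2 * fejer_prod N p).
  apply: measurable_funM => //.
  by apply/measurable_EFinP; exact: measurable_int iAA.
apply: (@le_trans _ _ (\int[mu2]_p ((B true p)%:E + (B false p)%:E))%E).
  apply: (le_trans (lee_abs _)).
  apply: (le_trans (le_abse_integral _ _ _)) => //; first exact/measurable_EFinP.
  apply: ge0_le_integral => //.
  - by apply: measurableT_comp => //; exact/measurable_EFinP.
  - by apply: emeasurable_funD; exact/measurable_EFinP.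
  move=> p _; rewrite /= -EFinD lee_fin normrM (ger0_norm (fejer_prod_ge0 p N0)).
  rewrite /B -mulrDl ler_wpM2r ?fejer_prod_ge0// normrM.
  rewrite -(real_normK (num_real (A p.1))) -(real_normK (num_real (A p.2))).
  by have := sqr_ge0 (`|A p.1| - `|A p.2|); nra.
rewrite ge0_integralD//; [|by move=> p _; rewrite lee_fin|exact/measurable_EFinP|
                          by move=> p _; rewrite lee_fin|exact/measurable_EFinP].
have -> : ((5 * pi) ^+ n)%:E = (((5 * pi) ^+ n / 2)%:E + ((5 * pi) ^+ n / 2)%:E)%E :> \bar R.
  by rewrite -EFinD -splitr.
rewrite ge0_muleDl ?lee_fin ?divr_ge0 ?exprn_ge0 ?mulr_ge0 ?pi_ge0//.
have half_energy := half_energy_le N0 mA2 (fun z => sqr_ge0 (A z)).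
apply: leeD.
  rewrite (fubini_tonelli1 (EFin \o B true)); [exact: half_energy|
    exact/measurable_EFinP|by move=> p; rewrite lee_fin].
rewrite (fubini_tonelli2 (EFin \o B false)); [|exact/measurable_EFinP|by move=> p; rewrite lee_fin].
rewrite /fubini_G /=.
under eq_integral => y _ do under eq_integral => x _ do rewrite /B/= fejer_prodC.
exact: half_energy.
Qed.

End plancherel.

Section plancherel_limit.
Context (R : realType) (n : nat).
Local Notation mu := (lebesgue_rV R n).

Lemma window_cvg (x : 'rV[R]_n) : window k.+1%:R x @[k --> \oo] --> (1 : R).
Proof.
have E : \prod_(i < n) (1 : R) = 1 by rewrite big1.
rewrite -[X in _ --> X]E.
apply: cvg_big => [|i _]; first exact: mul_continuous.
exact: triangle_cvg.
Qed.

Lemma window_nd (x : 'rV[R]_n) M N : 0 < M -> M <= N -> window M x <= window N x.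
Proof.
move=> M0 MN; apply: ler_prod => i _.
by rewrite triangle_ge0 triangle_nd.
Qed.

(** The windows increase to one, so that monotone convergence removes them. *)
Lemma transform_L2_le (A : 'rV[R]_n -> R) : mu.-integrable setT (EFin \o A) ->
  (\int[mu]_x (cos_transform A x ^+ 2 + sin_transform A x ^+ 2)%:E <=
   ((5 * pi) ^+ n)%:E * \int[mu]_z (A z ^+ 2)%:E)%E.
Proof.
move=> iA.
have mA : measurable_fun setT A by apply/measurable_EFinP; exact: measurable_int iA.
pose E x := cos_transform A x ^+ 2 + sin_transform A x ^+ 2.
have E0 x : 0 <= E x by rewrite addr_ge0 ?sqr_ge0.
have mE : measurable_fun setT E.
  apply: measurable_funD; apply: measurable_funX.
    exact: measurable_cos_transform.
  exact: measurable_sin_transform.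
pose g k x := (window k.+1%:R x * E x)%:E.
have mg k : measurable_fun setT (g k).
  by apply/measurable_EFinP; apply: measurable_funM => //; exact: measurable_window.
have g0 k x : setT x -> (0 <= g k x)%E.
  by move=> _; rewrite lee_fin mulr_ge0// window_ge0.
have gnd x : setT x -> {homo g^~ x : k l / (k <= l)%N >-> (k <= l)%E}.
  move=> _ k l kl; rewrite lee_fin ler_wpM2r// window_nd// ler_nat.
  by rewrite ltnS.
have -> : (\int[mu]_x (E x)%:E = \int[mu]_x limn (g^~ x))%E.
  apply: eq_integral => x _; apply/esym/cvg_lim => //.
  apply: cvg_EFin; first exact: nearW.
  rewrite -[X in _ --> X]mul1r; apply: cvgM; last exact: cvg_cst.
  exact: window_cvg.
rewrite monotone_convergence//; apply: lime_le.
  apply: ereal_nondecreasing_is_cvgn => k l kl.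
  apply: ge0_le_integral; [by []|exact: g0|exact: mg|exact: mg|].
  by move=> x xT; exact: gnd.
by apply: nearW => k; exact: integral_window_energy_le.
Qed.

End plancherel_limit.

Section inv_fourier_L2.
Context (R : realType) (n : nat).
Local Notation mu := (lebesgue_rV R n).
Implicit Types (f g : 'rV[R]_n -> R[i]).

Local Notation ReF f := (fun x => complex.Re (f x)).
Local Notation ImF f := (fun x => complex.Im (f x)).

Lemma normc_sqrE (z : R[i]) : Normc.normc z ^+ 2 = complex.Re z ^+ 2 + complex.Im z ^+ 2.
Proof. by case: z => a b /=; rewrite sqr_sqrtr// addr_ge0 ?sqr_ge0. Qed.

Lemma Re_inv_fourier g x : in_L1 g -> complex.Re (inv_fourier g x) =
  (2 * pi) ^- n * (cos_transform (ReF g) x - sin_transform (ImF g) x).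
Proof.
move=> [iR iI]; rewrite /inv_fourier /cintegral /= mul0r subr0; congr (_ * _).
rewrite /cos_transform /sin_transform -RintegralB//.
- by apply: eq_Rintegral => z _; case: (g z).
- exact: integrable_cos_mul.
- exact: integrable_sin_mul.
Qed.

Lemma Im_inv_fourier g x : in_L1 g -> complex.Im (inv_fourier g x) =
  (2 * pi) ^- n * (sin_transform (ReF g) x + cos_transform (ImF g) x).
Proof.
move=> [iR iI]; rewrite /inv_fourier /cintegral /= mul0r addr0; congr (_ * _).
rewrite /cos_transform /sin_transform -RintegralD//.
- by apply: eq_Rintegral => z _; case: (g z) => a b /=; rewrite addrC.
- exact: integrable_sin_mul.
- exact: integrable_cos_mul.
Qed.

(** Plancherel's inequality, up to a constant: the real and imaginary parts of
    $g$ are transformed separately. *)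
Lemma inv_fourier_L2_le g : in_L1 g ->
  (\int[mu]_x (Normc.normc (inv_fourier g x) ^+ 2)%:E <=
   (2 * ((2 * pi) ^- n) ^+ 2 * (5 * pi) ^+ n)%:E *
   \int[mu]_z (Normc.normc (g z) ^+ 2)%:E)%E.
Proof.
move=> ig; have [iR iI] := ig.
have mR : measurable_fun setT (ReF g) by apply/measurable_EFinP; exact: measurable_int iR.
have mI : measurable_fun setT (ImF g) by apply/measurable_EFinP; exact: measurable_int iI.
set c := (2 * pi) ^- n.
pose E (A : 'rV[R]_n -> R) x := cos_transform A x ^+ 2 + sin_transform A x ^+ 2.
have E0 A x : 0 <= E A x by rewrite addr_ge0 ?sqr_ge0.
have mE A : measurable_fun setT A -> measurable_fun setT (E A).
  move=> mA; apply: measurable_funD; apply: measurable_funX.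
    exact: measurable_cos_transform.
  exact: measurable_sin_transform.
have c2 : 0 <= 2 * c ^+ 2 by rewrite mulr_ge0// sqr_ge0.
apply: (@le_trans _ _ ((2 * c ^+ 2)%:E *
   (\int[mu]_x (E (ReF g) x)%:E + \int[mu]_x (E (ImF g) x)%:E))%E).
  rewrite -ge0_integralD//; last 4 first.
  - by move=> x _; rewrite lee_fin.
  - by apply/measurable_EFinP; exact: mE.
  - by move=> x _; rewrite lee_fin.
  - by apply/measurable_EFinP; exact: mE.
  rewrite -ge0_integralZl//; last 2 first.
  - by apply: emeasurable_funD; apply/measurable_EFinP; exact: mE.
  - by move=> x _; rewrite adde_ge0// lee_fin.
  apply: ge0_le_integral => //.
  - by move=> x _; rewrite lee_fin sqr_ge0.
  - apply/measurable_EFinP.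
    under eq_fun do rewrite normc_sqrE Re_inv_fourier// Im_inv_fourier//.
    apply: measurable_funD; apply: measurable_funX; apply: measurable_funM.
    + exact: measurable_cst.
    + apply: measurable_funB; first exact: measurable_cos_transform.
      exact: measurable_sin_transform.
    + exact: measurable_cst.
    + apply: measurable_funD; first exact: measurable_sin_transform.
      exact: measurable_cos_transform.
  - apply: emeasurable_funM; first exact: measurable_cst.
    by apply: emeasurable_funD; apply/measurable_EFinP; exact: mE.
  move=> x _; rewrite normc_sqrE Re_inv_fourier// Im_inv_fourier// -/c -EFinD -EFinM lee_fin.
  rewrite /E; set p := cos_transform _ _; set q := sin_transform _ _.
  set r := sin_transform _ _; set s := cos_transform _ _.
  rewrite -subr_ge0 (_ : _ - _ = c ^+ 2 * ((p + q) ^+ 2 + (r - s) ^+ 2)); last by ring.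
  by rewrite mulr_ge0 ?addr_ge0 ?sqr_ge0.
rewrite [X in (_ <= X * _)%E]EFinM -[leRHS]muleA lee_wpmul2l ?lee_fin//.
under [X in (_ <= _ * X)%E]eq_integral do rewrite normc_sqrE EFinD.
rewrite ge0_integralD//; last 4 first.
- by move=> x _; rewrite lee_fin sqr_ge0.
- by apply/measurable_EFinP; exact: measurable_funX.
- by move=> x _; rewrite lee_fin sqr_ge0.
- by apply/measurable_EFinP; exact: measurable_funX.
rewrite ge0_muleDr; [|by apply: integral_ge0 => x _; rewrite lee_fin sqr_ge0
  |by apply: integral_ge0 => x _; rewrite lee_fin sqr_ge0].
by apply: leeD; exact: transform_L2_le.
Qed.

End inv_fourier_L2.

(** * Bounds on the propagator *)

Section propagator_bound.
Context (R : realType) (n : nat).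
Implicit Types (w a : 'rV[R]_n -> R) (t x : R).

Lemma mul_expRN_le1 x : x * expR (- x) <= 1.
Proof.
rewrite expRN ler_pdivrMr ?expR_gt0// mul1r (le_trans _ (expR_ge1Dx x))//.
by rewrite lerDr.
Qed.

Lemma norm_sinc_le1 x : `|sinc x| <= 1.
Proof.
rewrite /sinc; case: eqVneq => [_|x0]; first by rewrite normr1.
by rewrite normrM normfV ler_pdivrMl ?normr_gt0// mulr1 norm_sin_le.
Qed.

Lemma norm_sinc_le_inv x : x != 0 -> `|sinc x| <= `|x|^-1.
Proof.
move=> x0; rewrite /sinc (negbTE x0) normrM normfV.
by rewrite ler_piMr ?invr_ge0// sin_max.
Qed.

(** The propagator is the displacement of a damped oscillator that leaves
    its rest position with unit speed. Its speed never exceeds one, which gives the bound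
    $t$. For the bound $2/w$: if $a\le w$, then it oscillates at a frequency of at
    least $w/2$; if $w<a<2w$, the factor $te^{-at/2}$ is at most $2/a$; if
    $a\ge2w$, either the gap $s$ of the characteristic roots is at least $w$,
    and the propagator is at most $1/s$, or both roots are below $-w/2$,
    and it is at most $te^{-wt/2}$. *)
Lemma propagator_le w a t xi : 0 <= t -> 0 < w xi -> 0 < a xi ->
  `|propagator w a t xi| <= t /\ `|propagator w a t xi| <= 2 / w xi.
Proof.
move=> t0 w0 a0; rewrite /propagator.
have tdecay b : 0 < b -> t * expR (- (b * t)) <= b^-1.
  by move=> b0; rewrite -(ler_pM2l b0) mulfV ?gt_eqF// mulrA mul_expRN_le1.
have le1 b : 0 <= b -> expR (- (b * t)) <= 1.
  by move=> b0; rewrite expR_le1 oppr_le0 mulr_ge0.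
set W := w xi in w0 *; set A := a xi in a0 *.
have W2 : 0 < 2 / W by rewrite divr_gt0.
case: ifPn => [AW|].
- have -> : - A * t / 2 = - ((A / 2) * t) by field.
  set r := t * W * Num.sqrt (1 - _).
  have E0 : 0 <= expR (- (A / 2 * t)) by exact: expR_ge0.
  have E1 : expR (- (A / 2 * t)) <= 1 by rewrite le1// divr_ge0// ltW.
  have sr := norm_sinc_le1 r.
  rewrite !normrM (ger0_norm E0) (ger0_norm t0); split.
    by rewrite -[leRHS]mulr1 ler_pM ?mulr_ge0// -[leRHS]mul1r ler_wpM2r.
  have [WA|AleW] := ltP W A.
    apply: (@le_trans _ _ (t * expR (- (A / 2 * t)))).
      by rewrite [leRHS]mulrC ler_piMr// mulr_ge0.
    rewrite (le_trans (tdecay _ _)) ?divr_gt0// invf_div ler_pM2l//.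
    by rewrite lef_pV2// ltW.
  have [->|tn0] := eqVneq t 0; first by rewrite mulr0 mul0r ltW.
  have t0' : 0 < t by rewrite lt_def tn0.
  have s2 : 2^-1 <= Num.sqrt (1 - a_tilde w a xi).
    rewrite -(ler_pXn2r (n := 2)) ?nnegrE ?sqrtr_ge0// ?invr_ge0//.
    have : a_tilde w a xi <= 4^-1.
      rewrite /a_tilde -/A -/W ler_pdivrMr ?mulr_gt0 ?exprn_gt0// mulrA mulVf// mul1r.
      by rewrite lerXn2r// nnegrE ltW.
    move=> h; rewrite sqr_sqrtr; last by lra.
    by rewrite expr2; lra.
  have r0 : 0 < r.
    by rewrite mulr_gt0 ?mulr_gt0// (lt_le_trans _ s2)// invr_gt0.
  apply: (@le_trans _ _ (t * `|sinc r|)).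
    by rewrite -mulrA ler_piMl// mulr_ge0.
  apply: (@le_trans _ _ (t * r^-1)).
    by rewrite ler_wpM2l// -[r in leRHS]gtr0_norm// norm_sinc_le_inv// gt_eqF.
  rewrite ler_pdivrMr//.
  have -> : 2 / W * r = t * (2 * Num.sqrt (1 - a_tilde w a xi)).
    by rewrite /r; field; rewrite gt_eqF.
  rewrite -[leLHS]mulr1 ler_wpM2l//; lra.
rewrite -leNgt => AW; case: eqVneq => [A2W|An2W].
- rewrite normrM (ger0_norm t0) (ger0_norm (expR_ge0 _)) mulNr; split.
    by rewrite -[leRHS]mulr1 ler_wpM2l// le1// ltW.
  rewrite (le_trans (tdecay _ w0))// -[leLHS]mul1r ler_wpM2r ?invr_ge0 ?ltW//.
  by lra.
have A2W : 2 * W < A.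
  by rewrite lt_def An2W/= leNgt; apply/negP => A2W; nra.
set s := Num.sqrt (A ^+ 2 - 4 * W ^+ 2).
have s0 : 0 < s.
  by rewrite sqrtr_gt0 subr_gt0; nra.
have ss : s ^+ 2 = A ^+ 2 - 4 * W ^+ 2 by rewrite sqr_sqrtr// subr_ge0.
have sA : s <= A.
  have := sqr_ge0 W; rewrite leNgt => W20; apply/negP => As; nra.
have -> : lambda_plus w a xi = - ((A - s) / 2) by rewrite /lambda_plus -/A -/W -/s; field.
have -> : lambda_minus w a xi = - ((A - s) / 2) - s by rewrite /lambda_minus -/A -/W -/s; field.
have b0 : 0 <= (A - s) / 2 by rewrite divr_ge0// subr_ge0.
set b := (A - s) / 2 in b0 *.
have -> : - b - (- b - s) = s by ring.
have -> : expR (- b * t) - expR ((- b - s) * t) =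
    expR (- (b * t)) * (1 - expR (- (s * t))).
  by rewrite mulrBr mulr1 -expRD mulNr; congr (_ - expR _); ring.
have st0 : 0 <= s * t by rewrite mulr_ge0// ltW.
have g0 : 0 <= 1 - expR (- (s * t)) by rewrite subr_ge0 expR_le1 oppr_le0.
have g1 : 1 - expR (- (s * t)) <= 1 by rewrite gerBl expR_ge0.
have gst : 1 - expR (- (s * t)) <= s * t by have := expR_ge1Dx (- (s * t)); lra.
have E0 := expR_ge0 (- (b * t)); have E1 := le1 _ b0.
rewrite ger0_norm; last by rewrite divr_ge0 ?mulr_ge0// ltW.
have m1 : expR (- (b * t)) * (1 - expR (- (s * t))) / s <= expR (- (b * t)) * t.
  by rewrite ler_pdivrMr// -[leRHS]mulrA ler_wpM2l// [t * s]mulrC.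
split; first by rewrite (le_trans m1)// ler_piMl.
have [Ws|sW] := leP W s.
  rewrite ler_pdivrMr// (@le_trans _ _ 1) ?mulr_ile1//.
  by rewrite mulrAC ler_pdivlMr// mul1r; lra.
have bW : W / 2 <= b by rewrite /b; lra.
have b1 : 0 < b by rewrite (lt_le_trans _ bW)// divr_gt0.
rewrite (le_trans m1)// mulrC (le_trans (tdecay _ b1))//.
by rewrite -[leRHS]invf_div lef_pV2// posrE divr_gt0.
Qed.

End propagator_bound.

(** * Measurability of the propagator, and dyadic cubes *)

Section punctured_measurability.
Context (R : realType).

Lemma measurable_invr : measurable_fun setT (@GRing.inv R).
Proof.
have -> : [set: R] = [set 0] `|` [set x | x != 0].
  by apply/esym/seteqP; split => // x _ /=; have [->|] := eqVneq x 0; [left|right].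
have mn0 : measurable [set x : R | x != 0] by apply: open_measurable; exact: open_neq.
apply/measurable_funU => //; split; first exact: measurable_fun_set1.
apply: open_continuous_measurable_fun; first exact: open_neq.
by move=> x; rewrite inE/=; exact: inv_continuous.
Qed.

Lemma measurable_sqrtr : measurable_fun setT (@Num.sqrt R).
Proof. by apply: continuous_measurable_fun; exact: sqrt_continuous. Qed.

Lemma measurable_sinc : measurable_fun setT (@sinc R).
Proof.
apply: measurable_fun_ifT.
- by apply: measurable_fun_eqr; [exact: measurable_id|exact: measurable_cst].
- exact: measurable_cst.
- apply: measurable_funM; first exact: measurable_invr.
  by apply: continuous_measurable_fun; exact: continuous_sin.
Qed.

Context (n : nat).

Lemma open_punctured : open (@punctured R n).
Proof.
rewrite (_ : @punctured R n = ~` [set 0]).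
  apply: closed_openC; apply: accessible_closed_set1.
  by apply: hausdorff_accessible; exact: norm_hausdorff.
by apply/seteqP; split => x /= /eqP.
Qed.

(** The origin is measurable and carries a single value. *)
Lemma measurable_fun_punctured (f : 'rV[R]_n -> R) :
  (forall x, @punctured R n x -> {for x, continuous f}) -> measurable_fun setT f.
Proof.
move=> cf.
have -> : [set: 'rV[R]_n] = [set 0] `|` @punctured R n.
  by apply/esym/seteqP; split => // x _ /=; have [->|] := eqVneq x 0; [left|right].
have mp : measurable (@punctured R n) by apply: open_measurable_rV; exact: open_punctured.
apply/measurable_funU => //.
  rewrite (_ : [set 0] = ~` @punctured R n); first exact: measurableC.
  by apply/seteqP; split => x /=; [move=> -> /eqP|move=> /negP; rewrite negbK => /eqP].
split; first exact: measurable_fun_set1.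
by apply: open_continuous_measurable_rV => //; exact: open_punctured.
Qed.

Lemma measurable_propagator (w a : 'rV[R]_n -> R) t :
  measurable_fun setT w -> measurable_fun setT a ->
  measurable_fun setT (propagator w a t).
Proof.
move=> mw ma.
have mc (c : R) : measurable_fun [set: 'rV[R]_n] (fun=> c) by exact: measurable_cst.
have mV (f : 'rV[R]_n -> R) : measurable_fun setT f -> measurable_fun setT (fun x => (f x)^-1).
  by move=> mf; exact: (measurableT_comp measurable_invr mf).
have mE (f : 'rV[R]_n -> R) : measurable_fun setT f -> measurable_fun setT (fun x => expR (f x)).
  by move=> mf; exact: (measurableT_comp (@measurable_expR R) mf).
have mN (f : 'rV[R]_n -> R) : measurable_fun setT f -> measurable_fun setT (fun x => - f x).
  by move=> mf; under eq_fun do rewrite -sub0r; exact: measurable_funB.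
have mS (f : 'rV[R]_n -> R) : measurable_fun setT f ->
    measurable_fun setT (fun x => Num.sqrt (f x)).
  by move=> mf; exact: (measurableT_comp measurable_sqrtr mf).
have mw2 : measurable_fun setT (fun x => 4 * w x ^+ 2).
  by apply: measurable_funM => //; exact: measurable_funX.
have ma2 : measurable_fun setT (fun x => a x ^+ 2) by exact: measurable_funX.
have mD : measurable_fun setT (fun x => Num.sqrt (a x ^+ 2 - 4 * w x ^+ 2)).
  by apply: mS; exact: measurable_funB.
have mlp : measurable_fun setT (lambda_plus w a).
  by apply: measurable_funM => //; apply: measurable_funD => //; exact: mN.
have mlm : measurable_fun setT (lambda_minus w a).
  by apply: measurable_funM => //; apply: measurable_funB => //; exact: mN.
apply: measurable_fun_ifT.
- exact: measurable_fun_ltr.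
- apply: measurable_funM.
    apply: measurable_funM => //; apply: mE; do 2 apply: measurable_funM => //.
    exact: mN.
  apply: (measurableT_comp measurable_sinc); apply: measurable_funM.
    exact: measurable_funM.
  apply: mS; apply: measurable_funB => //; apply: measurable_funM => //.
  exact: mV.
- apply: measurable_fun_ifT.
  + by apply: measurable_fun_eqr => //; exact: measurable_funM.
  + apply: measurable_funM => //; apply: mE; apply: measurable_funM => //.
    exact: mN.
  + apply: measurable_funM.
      by apply: measurable_funB; apply: mE; exact: measurable_funM.
    by apply: mV; exact: measurable_funB.
Qed.

End punctured_measurability.

Section dyadic.
Context (R : realType) (n : nat).
Local Notation mu := (lebesgue_rV R n).

Definition cube (r : R) : set 'rV[R]_n := [set x | `|x| <= r].

Lemma mx_norm_leP (x : 'rV[R]_n) r : 0 <= r ->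
  `|x| <= r <-> forall i, `|x 0 i| <= r.
Proof.
move=> r0; rewrite [`|x|]mx_normrE; split.
  move=> h i; apply: le_trans h.
  by rewrite (le_bigmax _ (fun j : 'I_1 * 'I_n => `|x j.1 j.2|) (0, i)).
by move=> h; apply/bigmax_leP; split => // -[i j] _ /=; rewrite ord1.
Qed.

Lemma cubeE r : 0 <= r -> cube r = [set x | forall i, `[(- r), r]%classic (x 0 i)].
Proof.
move=> r0; apply/seteqP; split => x.
  by move=> /(mx_norm_leP _ r0) h i /=; rewrite in_itv/= -ler_norml.
by move=> h; apply/(mx_norm_leP _ r0) => i; have := h i; rewrite /= in_itv/= -ler_norml.
Qed.

Lemma closed_cube r : closed (cube r).
Proof.
have := (@continuous_closedP _ _ (@Num.norm R 'rV[R]_n)).1 (@norm_continuous R _).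
by move=> /(_ [set y | y <= r]); apply; exact: closed_le.
Qed.

Lemma measurable_cube r : measurable (cube r).
Proof.
rewrite -[cube r]setCK; apply: measurableC; apply: open_measurable_rV.
by apply: closed_openC; exact: closed_cube.
Qed.

Lemma compact_cube r : compact (cube r).
Proof.
apply: bounded_closed_compact; last exact: closed_cube.
exists r; split; first exact: num_real.
by move=> M rM x /= xr; rewrite (le_trans xr)// ltW.
Qed.

Lemma lebesgue_cube r : 0 <= r -> mu (cube r) = ((2 * r) ^+ n)%:E.
Proof.
move=> r0; rewrite cubeE// (@lebesgue_rV_box R n (fun=> `[(- r), r]%classic))//.
rewrite (eq_bigr (fun=> (2 * r)%:E)); last first.
  move=> i _; rewrite lebesgue_measure_itv/= lte_fin.
  case: ltP => [_|rr]; first by rewrite -EFinD opprK mulr_natl.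
  by congr EFin; lra.
by rewrite prodEFin prodr_const card_ord.
Qed.

Lemma le_integral_subcube (F : 'rV[R]_n -> R) r T (D : set 'rV[R]_n) :
  0 <= r -> 0 <= T -> measurable D -> D `<=` cube r ->
  measurable_fun setT F -> (forall x, 0 <= F x) -> (forall x, D x -> F x <= T) ->
  (\int[mu]_(x in D) (F x)%:E <= (T * (2 * r) ^+ n)%:E)%E.
Proof.
move=> r0 T0 mD Dr mF F0 FT.
apply: (@le_trans _ _ (\int[mu]_(x in D) (cst T%:E) x)%E).
  apply: ge0_le_integral => //.
  - by move=> x _; rewrite lee_fin.
  - by apply/measurable_EFinP; exact: measurable_funTS.
rewrite (integral_cst mu mD) EFinM -lebesgue_cube// lee_wpmul2l ?lee_fin//.
by apply: le_measure => //; rewrite inE//; exact: measurable_cube.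
Qed.

(** Halving the cube $J$ times: on each dyadic shell the bound $M/|x|^n$ compensates
    the volume, so that every shell costs the same amount $4^nM$. *)
Lemma integral_dyadic_le (F : 'rV[R]_n -> R) M T r J :
  0 < r -> measurable_fun setT F -> (forall x, 0 <= F x) -> 0 <= M ->
  (forall x, F x <= T) -> (forall x, `|x| ^+ n * F x <= M) ->
  (\int[mu]_(x in cube r) (F x)%:E <=
   (J%:R * (4 ^+ n * M) + T * (2 * (r / 2 ^+ J)) ^+ n)%:E)%E.
Proof.
move=> r0 mF F0 M0 FT FM; have T0 : 0 <= T by exact: le_trans (F0 0) (FT 0).
elim: J r r0 => [|J IH] r r0.
  rewrite mul0r add0r expr0 divr1.
  by apply: le_integral_subcube => //; [exact: ltW|exact: measurable_cube].
have r20 : 0 < r / 2 by rewrite divr_gt0.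
have sub : cube (r / 2) `<=` cube r.
  by move=> x xr; apply: le_trans xr _; lra.
have -> : cube r = cube (r / 2) `|` (cube r `\` cube (r / 2)) by rewrite setDUK.
have mc := measurable_cube r; have mc2 := measurable_cube (r / 2).
rewrite ge0_integral_setU//; last 4 first.
- exact: measurableD.
- by apply/measurable_EFinP; exact: measurable_funTS.
- by move=> x _; rewrite lee_fin.
- by apply/disj_setPS => x [/= ? []].
have -> : J.+1%:R * (4 ^+ n * M) + T * (2 * (r / 2 ^+ J.+1)) ^+ n =
    J%:R * (4 ^+ n * M) + T * (2 * (r / 2 / 2 ^+ J)) ^+ n + 4 ^+ n * M.
  have -> : r / 2 ^+ J.+1 = r / 2 / 2 ^+ J by rewrite exprS invfM mulrA.
  by rewrite -addn1 natrD; ring.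
rewrite EFinD; apply: leeD; first exact: IH.
have -> : 4 ^+ n * M = M / (r / 2) ^+ n * (2 * r) ^+ n.
  have -> : 2 * r = 4 * (r / 2) by field.
  by rewrite [(4 * _) ^+ n]exprMn [RHS]mulrCA divfK// expf_neq0// gt_eqF.
apply: le_integral_subcube => //.
- exact: ltW.
- by rewrite divr_ge0// exprn_ge0// ltW.
- exact: measurableD.
- move=> x [_ /negP]; rewrite -ltNge => xr.
  have xn0 : 0 < (r / 2) ^+ n by rewrite exprn_gt0.
  rewrite ler_pdivlMr// mulrC (le_trans _ (FM x))// ler_wpM2r//.
  by apply: lerXn2r; rewrite ?nnegrE// ltW.
Qed.

End dyadic.

(** * The logarithmic integral, the symbol and the cut-off *)

Section logarithmic_bound.
Context (R : realType).

(** The number $J$ of dyadic shells is the least integer above $2\log_2t$, so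
    that $2^J\ge t^2$: on the remaining cube, of volume $(2r)^n2^{-Jn}$, the
    bound by a multiple of $t^2$ is enough. As $J$ is of order $\log t$ and
    every shell has the same cost, the logarithm appears. *)
Lemma integral_log_le n (F : 'rV[R]_n -> R) (M1 M2 r t : R) :
  (0 < n)%N -> 0 < r -> 0 <= M1 -> 0 <= M2 -> 0 <= t ->
  measurable_fun setT F -> (forall x, 0 <= F x) ->
  (forall x, F x <= M1 * t ^+ 2) -> (forall x, `|x| ^+ n * F x <= M2) ->
  (\int[lebesgue_rV R n]_(x in cube r) (F x)%:E <=
   ((M1 * (2 * r) ^+ n + (1 + 2 / ln 2) * (4 ^+ n * M2)) *
    (1 + pos_part (ln t)))%:E)%E.
Proof.
have gen1 (d l : R) : 0 <= d -> 0 <= l -> 1 + d * l <= (1 + d) * (1 + l).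
  by move=> d0 l0; lra.
have gen2 (p q l : R) : 0 <= p -> 0 <= q -> 0 <= l -> p <= (p + q) * (1 + l).
  by move=> p0 q0 l0; rewrite -[leLHS]mulr1 ler_pM// ?lerDl.
have gen3 (x y p q l : R) : 0 <= p -> 0 <= l -> x <= q * (1 + l) -> y <= p ->
    x + y <= (p + q) * (1 + l).
  move=> p0 l0 xq yp; rewrite mulrDl addrC lerD// (le_trans yp)//.
  by rewrite -[leLHS]mulr1 ler_wpM2l// lerDl.
move=> n0 r0 M10 M20 t0 mF F0 F1 F2.
have V0 : 0 <= (2 * r) ^+ n by rewrite exprn_ge0// mulr_ge0// ltW.
have K0 : 0 <= 4 ^+ n * M2 by rewrite mulr_ge0// exprn_ge0.
have l2 : 0 < ln 2 :> R by rewrite ln_gt0// ltr1n.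
have d0 : 0 < 2 / ln 2 :> R by rewrite divr_gt0.
have L0 : 0 <= pos_part (ln t) by rewrite /pos_part le_max lexx orbT.
have MV0 : 0 <= M1 * (2 * r) ^+ n by rewrite mulr_ge0.
set K := 4 ^+ n * M2 in K0 *; set V := (2 * r) ^+ n in V0 MV0 *.
have [t1|t1] := leP t 1.
  apply: (le_trans (integral_dyadic_le 0 r0 mF F0 M20 F1 F2)).
  rewrite lee_fin mul0r add0r expr0 divr1 -/V.
  apply: (@le_trans _ _ (M1 * V)).
    rewrite mulrAC -[leRHS]mulr1 ler_wpM2l//.
    by rewrite exprn_ile1.
  have Q0 : 0 <= (1 + 2 / ln 2) * K by rewrite mulr_ge0// addr_ge0// ltW.
  exact: gen2.
have lt0 : 0 < ln t by rewrite ln_gt0.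
have -> : pos_part (ln t) = ln t by apply/max_idPl; exact: ltW.
pose J := (Num.truncn (2 * ln t / ln 2)).+1.
have J1 : 2 * ln t / ln 2 < J%:R by rewrite truncnS_gt.
have J2 : J%:R <= 1 + 2 * ln t / ln 2.
  rewrite /J -addn1 natrD addrC lerD2l truncn_le// divr_ge0 ?mulr_ge0//; exact: ltW.
have tJ : t ^+ 2 <= 2 ^+ J.
  rewrite -ler_ln ?posrE ?exprn_gt0// ?(lt_trans _ t1)//.
  rewrite !lnXn// ?(lt_trans _ t1)//.
  by move: J1; rewrite ltr_pdivrMr// mulr_natl => /ltW; rewrite [J%:R * _]mulr_natl.
apply: (le_trans (integral_dyadic_le J r0 mF F0 M20 F1 F2)).
rewrite lee_fin -/K.
have -> : (2 * (r / 2 ^+ J)) ^+ n = V / (2 ^+ J) ^+ n.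
  by rewrite mulrA expr_div_n.
have D1 : t ^+ 2 <= (2 ^+ J) ^+ n.
  by rewrite (le_trans tJ)// ler_eXnr// exprn_ege1// ler1n.
have D0 : 0 < (2 ^+ J) ^+ n :> R by rewrite !exprn_gt0.
have A : M1 * t ^+ 2 * (V / (2 ^+ J) ^+ n) <= M1 * V.
  rewrite mulrA ler_pdivrMr// mulrAC -!mulrA; do 2 rewrite ler_wpM2l//.
have B : J%:R * K <= (1 + 2 / ln 2) * K * (1 + ln t).
  rewrite mulrAC ler_wpM2r// (le_trans J2)//.
  by rewrite mulrAC gen1// ltW.
by apply: gen3 => //; exact: ltW.
Qed.

End logarithmic_bound.

Section symbol_lower_bound.
Context (R : realType).

(** Homogeneity reduces the bound to the unit sphere, which is compact. The
    square of $|x|^\sigma$ is the integer power $|x|^n$ since $n=2\sigma$. *)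
Lemma homogeneous_sqr_ge n (sigma : R) (w : 'rV[R]_n -> R) :
  (0 < n)%N -> n%:R = 2 * sigma -> homogeneous sigma w ->
  (forall x, x != 0 -> {for x, continuous w}) ->
  (forall x, x != 0 -> 0 < w x) ->
  exists2 c, 0 < c & forall x, x != 0 -> c * `|x| ^+ n <= w x ^+ 2.
Proof.
move=> n0 ns hw cw w0.
pose S : set 'rV[R]_n := [set x | `|x| = 1].
have Sn0 x : S x -> x != 0.
  by move=> Sx; apply/eqP => x0; have := Sx; rewrite /S/= x0 normr0 => /esym/eqP; rewrite oner_eq0.
have S0 : S !=set0.
  have u0 : const_mx 1 != 0 :> 'rV[R]_n.
    by apply/eqP => /rowP/(_ (Ordinal n0)); rewrite !mxE => /eqP; rewrite oner_eq0.
  exists (`|const_mx 1 : 'rV[R]_n|^-1 *: const_mx 1).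
  by rewrite /S/= normrZ normfV normr_id mulVf// normr_eq0.
have cS : compact S.
  apply: (subclosed_compact _ (@compact_cube R n 1)).
    have := (@continuous_closedP _ _ (@Num.norm R 'rV[R]_n)).1 (@norm_continuous R _).
    by move=> /(_ [set y | y = 1]); apply; exact: closed_eq.
  by move=> x; rewrite /S /cube /= => ->.
have [x0 /set_mem Sx0 minx0] : exists2 c, c \in S & forall t, t \in S -> w c <= w t.
  apply: EVT_min_rV => //; apply: continuous_in_subspaceT => x /set_mem Sx.
  exact/cw/Sn0.
have wx0 : 0 < w x0 by exact/w0/Sn0.
exists (w x0 ^+ 2) => [|x xn0]; first by rewrite exprn_gt0.
have nx0 : 0 < `|x| by rewrite normr_gt0.
have SV : S (`|x|^-1 *: x).
  by rewrite /S/= normrZ normfV normr_id mulVf// gt_eqF.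
have -> : w x = `|x| `^ sigma * w (`|x|^-1 *: x).
  by rewrite -hw ?scalerA ?mulfV ?scale1r ?gt_eqF//; exact: Sn0.
have -> : (`|x| `^ sigma * w (`|x|^-1 *: x)) ^+ 2 = w (`|x|^-1 *: x) ^+ 2 * `|x| ^+ n.
  rewrite exprMn mulrC; congr (_ * _).
  by rewrite -!powR_mulrn ?powR_ge0// -powRrM ns mulrC.
rewrite ler_wpM2r ?exprn_ge0// lerXn2r ?nnegrE ?(ltW wx0)//.
  by rewrite ltW//; exact/w0/Sn0.
by apply: minx0; exact/mem_set.
Qed.

End symbol_lower_bound.

Section test_functions.
Context (R : realType) (n : nat).
Implicit Types (chi : 'rV[R]_n -> R[i]).

Lemma test_function_bounded chi : test_function chi ->
  exists rM : R * R, [/\ 0 < rM.1, 0 < rM.2,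
    forall x, Normc.normc (chi x) ^+ 2 <= rM.2 &
    forall x, ~ cube rM.1 x -> chi x = 0].
Proof.
move=> [sR sI cK].
have cR : continuous (fun x => complex.Re (chi x)) by move=> x; exact: (sR 0%N).1.
have cI : continuous (fun x => complex.Im (chi x)) by move=> x; exact: (sI 0%N).1.
have /ex_strict_bound_gt0[r r0 Kr] := compact_bounded cK.
have chi0 x : ~ cube r x -> chi x = 0.
  apply: contra_notP => /eqP chix; apply/ltW/Kr; exact: subset_closure.
pose f x := complex.Re (chi x) ^+ 2 + complex.Im (chi x) ^+ 2.
have cf : continuous f.
  have -> : f = ((fun x => complex.Re (chi x)) * (fun x => complex.Re (chi x))) +
                ((fun x => complex.Im (chi x)) * (fun x => complex.Im (chi x))).
    by apply/funext => x; rewrite /f !fctE !expr2.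
  move=> x; apply: (@continuousD R R^o).
    by apply: continuousM; [exact: cR|exact: cR].
  by apply: continuousM; [exact: cI|exact: cI].
have [x0 _ maxx0] : exists2 c, c \in cube r & forall t, t \in cube r -> f t <= f c.
  apply: EVT_max_rV; [by exists 0; rewrite /cube/= normr0 ltW|exact: compact_cube|].
  exact: continuous_subspaceT.
have f0 x : 0 <= f x by rewrite addr_ge0 ?sqr_ge0.
exists (r, f x0 + 1); split => //=; first by rewrite ltr_wpDl.
  move=> x; rewrite normc_sqrE; have [xr|xr] := pselect (cube r x).
  apply: (@le_trans _ _ (f x0)); last by rewrite lerDl.
  by apply: maxx0; exact/mem_set.
by rewrite chi0//= expr0n/= addr0 ltW// ltr_wpDl.
Qed.

End test_functions.

Section fourier_bound.
Context (R : realType) (n : nat).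
Local Notation mu := (lebesgue_rV R n).

Lemma Re_fourier (u : 'rV[R]_n -> R[i]) xi : in_L1 u -> complex.Re (fourier u xi) =
  cos_transform (fun x => complex.Re (u x)) xi + sin_transform (fun x => complex.Im (u x)) xi.
Proof.
move=> [iR iI]; rewrite /fourier /cintegral /cos_transform /sin_transform -RintegralD//=.
- apply: eq_Rintegral => z _; case: (u z) => a b /=.
  by rewrite sinN cosN dotpC mulNr opprK.
- exact: integrable_cos_mul.
- exact: integrable_sin_mul.
Qed.

Lemma Im_fourier (u : 'rV[R]_n -> R[i]) xi : in_L1 u -> complex.Im (fourier u xi) =
  cos_transform (fun x => complex.Im (u x)) xi - sin_transform (fun x => complex.Re (u x)) xi.
Proof.
move=> [iR iI]; rewrite /fourier /cintegral /cos_transform /sin_transform -RintegralB//=.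
- apply: eq_Rintegral => z _; case: (u z) => a b /=.
  by rewrite sinN cosN dotpC mulNr.
- exact: integrable_cos_mul.
- exact: integrable_sin_mul.
Qed.

Lemma norm_cos_transform_le (A : 'rV[R]_n -> R) x : mu.-integrable setT (EFin \o A) ->
  `|cos_transform A x| <= \int[mu]_z `|A z|.
Proof.
move=> iA; apply: le_trans (le_normr_Rintegral _ (integrable_cos_mul x iA)) _ => //.
apply: le_Rintegral => //.
- exact/integrable_norm/integrable_cos_mul.
- exact: integrable_norm.
- by move=> z _; rewrite normrM ler_piMl// cos_max.
Qed.

Lemma norm_sin_transform_le (A : 'rV[R]_n -> R) x : mu.-integrable setT (EFin \o A) ->
  `|sin_transform A x| <= \int[mu]_z `|A z|.
Proof.
move=> iA; apply: le_trans (le_normr_Rintegral _ (integrable_sin_mul x iA)) _ => //.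
apply: le_Rintegral => //.
- exact/integrable_norm/integrable_sin_mul.
- exact: integrable_norm.
- by move=> z _; rewrite normrM ler_piMl// sin_max.
Qed.

End fourier_bound.

(** * Lebesgue norms and the Fourier transform of an integrable function *)

Section lebesgue_norms.
Context (R : realType) (n : nat).
Local Notation mu := (lebesgue_rV R n).
Implicit Types (f u : 'rV[R]_n -> R[i]).

Lemma normc_ge0 (z : R[i]) : 0 <= Normc.normc z.
Proof. by case: z => a b; exact: sqrtr_ge0. Qed.

Lemma norm_Re_le (z : R[i]) : `|complex.Re z| <= Normc.normc z.
Proof.
rewrite -(ler_pXn2r (n := 2)) ?nnegrE ?normc_ge0// normc_sqrE real_normK ?num_real//.
by rewrite lerDl sqr_ge0.
Qed.

Lemma norm_Im_le (z : R[i]) : `|complex.Im z| <= Normc.normc z.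
Proof.
rewrite -(ler_pXn2r (n := 2)) ?nnegrE ?normc_ge0// normc_sqrE real_normK ?num_real//.
by rewrite lerDr sqr_ge0.
Qed.

Lemma measurable_normc f : measurable_fun setT (fun x => complex.Re (f x)) ->
  measurable_fun setT (fun x => complex.Im (f x)) ->
  measurable_fun setT (fun x => Normc.normc (f x)).
Proof.
move=> mR mI.
have -> : (fun x => Normc.normc (f x)) =
    fun x => Num.sqrt (complex.Re (f x) ^+ 2 + complex.Im (f x) ^+ 2).
  by apply/funext => x; case: (f x).
apply: (measurableT_comp (@measurable_sqrtr R)).
by apply: measurable_funD; exact: measurable_funX.
Qed.

Lemma integrable_normc u : in_L1 u ->
  mu.-integrable setT (EFin \o (fun x => Normc.normc (u x))).
Proof.
move=> [iR iI].
have mR : measurable_fun setT (fun x => complex.Re (u x)).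
  by apply/measurable_EFinP; exact: measurable_int iR.
have mI : measurable_fun setT (fun x => complex.Im (u x)).
  by apply/measurable_EFinP; exact: measurable_int iI.
have isum : mu.-integrable setT
    (fun x => (`|complex.Re (u x)|%:E + `|complex.Im (u x)|%:E)%E).
  by apply: integrableD => //; exact: integrable_norm.
apply: le_integrable isum => //.
  by apply/measurable_EFinP; exact: measurable_normc.
move=> x _; rewrite /= lee_fin (ger0_norm (normc_ge0 _)) [leRHS]ger0_norm ?addr_ge0//.
rewrite -(ler_pXn2r (n := 2)) ?nnegrE ?addr_ge0 ?normc_ge0//.
rewrite normc_sqrE sqrrD !real_normK ?num_real//.
by rewrite addrAC lerDl mulrn_wge0// mulr_ge0.
Qed.

Lemma Lp_norm1E u : in_L1 u -> Lp_norm 1%:E u = (\int[mu]_x Normc.normc (u x))%:E.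
Proof.
move=> iu; rewrite /Lp_norm Lnorm1 /Rintegral fineK; last first.
  exact: integrable_fin_num (integrable_normc iu).
by apply: eq_integral => x _; rewrite /= ger0_norm// normc_ge0.
Qed.

Lemma Lp_norm2_le f D : (\int[mu]_x (Normc.normc (f x) ^+ 2)%:E <= D%:E)%E ->
  (Lp_norm 2%:E f <= (Num.sqrt D)%:E)%E.
Proof.
move=> fD.
have I0 : (0 <= \int[mu]_x (Normc.normc (f x) ^+ 2)%:E)%E.
  by apply: integral_ge0 => x _; rewrite lee_fin sqr_ge0.
have D0 : 0 <= D by rewrite -lee_fin (le_trans I0).
rewrite /Lp_norm unlock.
rewrite (eq_integral (fun x => (Normc.normc (f x) ^+ 2)%:E)); last first.
  by move=> x _; rewrite /= ger0_norm ?normc_ge0// powR_mulrn ?normc_ge0.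
rewrite -powR12_sqrt// -poweR_EFin.
by apply: gt0_ler_poweR => //; rewrite ?in_itv/= ?leey ?I0 ?lee_fin ?invr_ge0 ?D0//.
Qed.

(** The constant $8$ comes from estimating the four real transforms one by
    one. *)
Lemma fourier_sup_le u xi : in_L1 u ->
  Normc.normc (fourier u xi) ^+ 2 <= 8 * (\int[mu]_x Normc.normc (u x)) ^+ 2.
Proof.
move=> iu; have [iR iI] := iu; rewrite normc_sqrE Re_fourier// Im_fourier//.
set I := \int[mu]_x _.
have I0 : 0 <= I by apply: Rintegral_ge0 => x _; exact: normc_ge0.
have IR : \int[mu]_z `|complex.Re (u z)| <= I.
  apply: le_Rintegral => //; [exact: integrable_norm|exact: integrable_normc|].
  by move=> x _; exact: norm_Re_le.
have II : \int[mu]_z `|complex.Im (u z)| <= I.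
  apply: le_Rintegral => //; [exact: integrable_norm|exact: integrable_normc|].
  by move=> x _; exact: norm_Im_le.
have := le_trans (norm_cos_transform_le xi iR) IR.
have := le_trans (norm_cos_transform_le xi iI) II.
have := le_trans (norm_sin_transform_le xi iR) IR.
have := le_trans (norm_sin_transform_le xi iI) II.
clear - I0; move: (cos_transform _ _) (cos_transform _ _) => p q.
move: (sin_transform _ _) (sin_transform _ _) => r s.
have sq (x : R) : `|x| <= I -> x ^+ 2 <= I ^+ 2.
  by move=> xI; rewrite -[x ^+ 2]real_normK ?num_real//; apply: lerXn2r.
move=> /sq h1 /sq h2 /sq h3 /sq h4.
have := sqr_ge0 (p - s); have := sqr_ge0 (q + r).
move: h1 h2 h3 h4; clear.
by move=> *; lra.
Qed.

Lemma integrable_bounded_support (h : 'rV[R]_n -> R) r B : 0 <= r -> 0 <= B ->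
  measurable_fun setT h -> (forall x, `|h x| <= B) -> (forall x, ~ cube r x -> h x = 0) ->
  mu.-integrable setT (EFin \o h).
Proof.
move=> r0 B0 mh hB h0; apply/integrableP; split; first exact/measurable_EFinP.
have -> : (\int[mu]_x `|(EFin \o h) x| = \int[mu]_(x in cube r) (`|h x|)%:E)%E.
  rewrite [RHS]integral_mkcond; apply: eq_integral => x _; rewrite patchE /=.
  by case: ifPn => //; rewrite notin_setE => /h0 ->; rewrite normr0.
apply: (@le_lt_trans _ _ (B * (2 * r) ^+ n)%:E); last exact: ltry.
apply: le_integral_subcube => //; first exact: measurable_cube.
exact: measurableT_comp.
Qed.

Lemma lebesgue_set0 : (0 < n)%N -> mu [set 0] = 0%E.
Proof.
move=> n0; have -> : [set 0 : 'rV[R]_n] = cube 0.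
  apply/seteqP; split => x; first by move=> ->; rewrite /cube/= normr0.
  by rewrite /cube/= normr_le0 => /eqP.
by rewrite lebesgue_cube// mulr0 expr0n gtn_eqF.
Qed.

End lebesgue_norms.

(** * The low-frequency estimate *)

Section cut_off_solution.
Context (R : realType) (n : nat).
Local Notation mu := (lebesgue_rV R n).
Variables (w a : 'rV[R]_n -> R) (chi : 'rV[R]_n -> R[i]).
Hypothesis n0 : (0 < n)%N.
Hypothesis cw : forall x, x != 0 -> {for x, continuous w}.
Hypothesis ca : forall x, x != 0 -> {for x, continuous a}.
Hypothesis w0 : forall x, x != 0 -> 0 < w x.
Hypothesis a0 : forall x, x != 0 -> 0 < a x.
Variable c : R.
Hypothesis c0 : 0 < c.
Hypothesis wc : forall x, x != 0 -> c * `|x| ^+ n <= w x ^+ 2.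
Variables r M : R.
Hypothesis r0 : 0 < r.
Hypothesis M0 : 0 < M.
Hypothesis chiR : measurable_fun setT (fun x => complex.Re (chi x)).
Hypothesis chiI : measurable_fun setT (fun x => complex.Im (chi x)).
Hypothesis chiM : forall x, Normc.normc (chi x) ^+ 2 <= M.
Hypothesis chi0 : forall x, ~ cube r x -> chi x = 0.

Variables (t : R) (u : 'rV[R]_n -> R[i]).
Hypothesis t0 : 0 <= t.
Hypothesis iu : in_L1 u.

Let g xi := chi xi * u_hat w a u t xi.
Let N := \int[mu]_x Normc.normc (u x).

Let sqr_normcM (x y : R[i]) :
  Normc.normc (x * y) ^+ 2 = Normc.normc x ^+ 2 * Normc.normc y ^+ 2.
Proof. by rewrite Normc.normcM exprMn. Qed.

Let sqr_norm_g xi : Normc.normc (g xi) ^+ 2 =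
  Normc.normc (chi xi) ^+ 2 * propagator w a t xi ^+ 2 * Normc.normc (fourier u xi) ^+ 2.
Proof.
by rewrite /g /u_hat !sqr_normcM mulrA [X in _ * X * _]normc_sqrE/= expr0n/= addr0.
Qed.

Let mw : measurable_fun setT w.
Proof. by apply: measurable_fun_punctured => x; exact: cw. Qed.

Let ma : measurable_fun setT a.
Proof. by apply: measurable_fun_punctured => x; exact: ca. Qed.

Let mp : measurable_fun setT (propagator w a t).
Proof. exact: measurable_propagator. Qed.

Let mRu : measurable_fun setT (fun x => complex.Re (u x)).
Proof. by apply/measurable_EFinP; exact: measurable_int iu.1. Qed.

Let mIu : measurable_fun setT (fun x => complex.Im (u x)).
Proof. by apply/measurable_EFinP; exact: measurable_int iu.2. Qed.

Let mRF : measurable_fun setT (fun x => complex.Re (fourier u x)).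
Proof.
under eq_fun do rewrite Re_fourier//.
by apply: measurable_funD; [exact: measurable_cos_transform|exact: measurable_sin_transform].
Qed.

Let mIF : measurable_fun setT (fun x => complex.Im (fourier u x)).
Proof.
under eq_fun do rewrite Im_fourier//.
by apply: measurable_funB; [exact: measurable_cos_transform|exact: measurable_sin_transform].
Qed.

Let mRg : measurable_fun setT (fun x => complex.Re (g x)).
Proof.
rewrite (_ : (fun x => _) = fun x => propagator w a t x *
  (complex.Re (chi x) * complex.Re (fourier u x) - complex.Im (chi x) * complex.Im (fourier u x))).
  by apply: measurable_funM => //; apply: measurable_funB; exact: measurable_funM.
apply/funext => x; rewrite /g /u_hat; case: (chi x) (fourier u x) => p q [p' q'] /=.
by ring.
Qed.

Let mIg : measurable_fun setT (fun x => complex.Im (g x)).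
Proof.
rewrite (_ : (fun x => _) = fun x => propagator w a t x *
  (complex.Re (chi x) * complex.Im (fourier u x) + complex.Im (chi x) * complex.Re (fourier u x))).
  by apply: measurable_funM => //; apply: measurable_funD; exact: measurable_funM.
apply/funext => x; rewrite /g /u_hat; case: (chi x) (fourier u x) => p q [p' q'] /=.
by ring.
Qed.

Let g0 x : ~ cube r x -> g x = 0.
Proof. by move=> /chi0; rewrite /g => ->; rewrite mul0r. Qed.

Let sqr_norm_g_le xi m : `|propagator w a t xi| <= m ->
  Normc.normc (g xi) ^+ 2 <= 8 * M * N ^+ 2 * m ^+ 2.
Proof.
move=> pm; rewrite sqr_norm_g.
have m2 : propagator w a t xi ^+ 2 <= m ^+ 2.
  rewrite -[propagator _ _ _ _ ^+ 2]real_normK ?num_real//; apply: lerXn2r => //.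
  by rewrite nnegrE (le_trans _ pm).
have := fourier_sup_le xi iu; rewrite -/N => F2.
rewrite (_ : 8 * M * N ^+ 2 * m ^+ 2 = M * m ^+ 2 * (8 * N ^+ 2)); last by ring.
apply: ler_pM; [by rewrite mulr_ge0 ?sqr_ge0|exact: sqr_ge0| |exact: F2].
by apply: ler_pM; rewrite ?sqr_ge0.
Qed.

Lemma cutoff_u_hat_L1 : in_L1 g.
Proof.
(* The bound by $t$ is only available off the origin. *)
pose m := Num.max t `|propagator w a t 0|.
have m0 : 0 <= m by rewrite le_max t0.
have pm xi : `|propagator w a t xi| <= m.
  rewrite le_max; have [->|xi0] := eqVneq xi 0; first by rewrite lexx orbT.
  by rewrite (propagator_le t0 (w0 xi0) (a0 xi0)).1.
have gB xi : Normc.normc (g xi) <= Num.sqrt (8 * M * N ^+ 2 * m ^+ 2).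
  by rewrite -[leLHS]ger0_norm ?normc_ge0// -sqrtr_sqr ler_wsqrtr// sqr_norm_g_le.
split; apply: (integrable_bounded_support (ltW r0) (sqrtr_ge0 _)) => //.
- by move=> x; exact: le_trans (norm_Re_le _) (gB x).
- by move=> x /g0 ->.
- by move=> x; exact: le_trans (norm_Im_le _) (gB x).
- by move=> x /g0 ->.
Qed.

(** The squared symbol is at most a multiple of $\min(t^2,4/w^2)$ on the support
    of the cut-off, and $4/w^2\le(4/c)|x|^{-n}$. *)
Lemma cutoff_u_hat_L2_le :
  (\int[mu]_x (Normc.normc (g x) ^+ 2)%:E <=
   ((8 * M * (2 * r) ^+ n + (1 + 2 / ln 2) * (4 ^+ n * (32 * M / c))) *
    (1 + pos_part (ln t)) * N ^+ 2)%:E)%E.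
Proof.
(* The bounds may fail at the origin, a null set, where $F$ is set to zero. *)
pose F x := if x == 0 then 0 else Normc.normc (g x) ^+ 2.
have mg2 : measurable_fun setT (fun x => Normc.normc (g x) ^+ 2).
  by apply: measurable_funX; exact: measurable_normc.
have m0 : measurable [set 0 : 'rV[R]_n].
  rewrite (_ : [set 0] = cube 0); first exact: measurable_cube.
  apply/seteqP; split => x; first by move=> ->; rewrite /cube/= normr0.
  by rewrite /cube/= normr_le0 => /eqP.
have mF : measurable_fun setT F.
  apply: measurable_fun_ifT => //.
  apply: (measurable_fun_bool true); rewrite setTI.
  rewrite (_ : _ @^-1` _ = [set 0])//.
  by apply/seteqP; split => x /= /eqP.
have F0 x : 0 <= F x by rewrite /F; case: ifP => // _; exact: sqr_ge0.
have MN0 : 0 <= 8 * M * N ^+ 2 by rewrite mulr_ge0 ?sqr_ge0// mulr_ge0// ltW.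
have F1 x : F x <= 8 * M * N ^+ 2 * t ^+ 2.
  rewrite /F; case: eqVneq => [_|x0]; first by rewrite mulr_ge0// sqr_ge0.
  by apply: sqr_norm_g_le; exact: (propagator_le t0 (w0 x0) (a0 x0)).1.
have C0 : 0 <= 32 * M / c * N ^+ 2.
  by rewrite mulr_ge0 ?sqr_ge0// divr_ge0 ?mulr_ge0// ltW.
have F2 x : `|x| ^+ n * F x <= 32 * M / c * N ^+ 2.
  rewrite /F; case: eqVneq => [_|x0].
    by rewrite mulr0.
  have wx0 : 0 < w x ^+ 2 by rewrite exprn_gt0// w0.
  apply: (@le_trans _ _ (`|x| ^+ n * (8 * M * N ^+ 2 * (2 / w x) ^+ 2))).
    rewrite ler_wpM2l ?exprn_ge0//.
    by apply: sqr_norm_g_le; exact: (propagator_le t0 (w0 x0) (a0 x0)).2.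
  have -> : `|x| ^+ n * (8 * M * N ^+ 2 * (2 / w x) ^+ 2) =
      32 * M / c * N ^+ 2 * (c * `|x| ^+ n / w x ^+ 2).
    by field; rewrite !gt_eqF// w0.
  by apply: ler_piMr => //; rewrite ler_pdivrMr// mul1r wc.
have -> : (\int[mu]_x (Normc.normc (g x) ^+ 2)%:E = \int[mu]_x (F x)%:E)%E.
  apply: ge0_ae_eq_integral => //.
  - exact/measurable_EFinP.
  - exact/measurable_EFinP.
  - by move=> x _; rewrite lee_fin sqr_ge0.
  - by move=> x _; rewrite lee_fin.
  exists [set 0]; split => //; first exact: lebesgue_set0.
  move=> x /= h; apply: contrapT => /eqP/negbTE xn0; apply: h => _.
  by rewrite /F xn0.
have -> : (\int[mu]_x (F x)%:E = \int[mu]_(x in cube r) (F x)%:E)%E.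
  rewrite [RHS]integral_mkcond; apply: eq_integral => x _; rewrite patchE.
  case: ifPn => //; rewrite notin_setE => /g0 gx0.
  by rewrite /F gx0 normc_sqrE/= expr0n/= addr0; case: ifP.
apply: (le_trans (integral_log_le n0 r0 MN0 C0 t0 mF F0 F1 F2)).
by rewrite lee_fin le_eqVlt; apply/orP; left; apply/eqP; ring.
Qed.

End cut_off_solution.

Theorem proposition1p1 (R : realType) (n : nat) (sigma : R)
  (w a : 'rV[R]_n -> R) (theta0 a0 C : R) (chi : 'rV[R]_n -> R[i])
  (hn : (1 <= n)%N) (hsigma : 0 < sigma) (hnsigma : n%:R = 2 * sigma)
  (w_smooth : smooth_on (@punctured R n) w)
  (w_homog : homogeneous sigma w)
  (w_rank : maximal_rank sigma w)
  (w_pos : forall xi, xi != 0 -> 0 < w xi)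
  (a_Ck : Ck_on n.+1 (@punctured R n) a)
  (a_pos : forall xi, xi != 0 -> 0 < a xi)
  (htheta0 : sigma < theta0) (ha0 : 0 < a0) (hC : 0 < C)
  (a_near0 : \forall xi \near (0 : 'rV[R]_n), xi != 0 ->
     a0 * enorm xi `^ theta0 <= a xi /\
     forall g : 'I_n -> nat, (multi_order g <= n.+1)%N ->
       `|multi_partial g a xi| <= C * enorm xi `^ (theta0 - (multi_order g)%:R))
  (chi_test : test_function chi)
  (chi_near0 : \forall xi \near (0 : 'rV[R]_n), chi xi = 1) :
  exists C' : R, 0 < C' /\
    forall (t : R) (u1 : 'rV[R]_n -> R[i]), 0 <= t -> in_L1 u1 ->
      (Lp_norm 2%:E (T_cutoff chi (u_hat w a u1 t))
       <= (C' * (1 + pos_part (ln t)) `^ (1 / 2))%:E * Lp_norm 1%:E u1)%E.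
Proof.
have n0 : (0 < n)%N by [].
have cw x : x != 0 -> {for x, continuous w} by exact: (w_smooth 0%N).1.
have ca x : x != 0 -> {for x, continuous a} by case: a_Ck => + _; exact.
have [c c0 wc] := homogeneous_sqr_ge n0 hnsigma w_homog cw w_pos.
have [[r M] [/= r0 M0 chiM chi0]] := test_function_bounded chi_test.
have [sR sI _] := chi_test.
have mR : measurable_fun setT (fun x => complex.Re (chi x)).
  by apply: open_continuous_measurable_rV; [exact: openT|exact: (sR 0%N).1].
have mI : measurable_fun setT (fun x => complex.Im (chi x)).
  by apply: open_continuous_measurable_rV; [exact: openT|exact: (sI 0%N).1].
pose P : R := 2 * ((2 * pi) ^- n) ^+ 2 * (5 * pi) ^+ n.
pose K := 8 * M * (2 * r) ^+ n + (1 + 2 / ln 2) * (4 ^+ n * (32 * M / c)).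
have P0 : 0 < P.
  by rewrite !mulr_gt0 ?exprn_gt0 ?invr_gt0 ?exprn_gt0 ?mulr_gt0 ?pi_gt0.
have K0 : 0 < K.
  have l2 : 0 < ln 2 :> R by rewrite ln_gt0// ltr1n.
  have V0 : 0 < (2 * r) ^+ n by rewrite exprn_gt0// mulr_gt0.
  have A0 : 0 < 1 + 2 / ln 2 :> R by rewrite addr_gt0// divr_gt0.
  have B0 : 0 < 4 ^+ n * (32 * M / c) by rewrite mulr_gt0 ?exprn_gt0// divr_gt0// mulr_gt0.
  by apply: addr_gt0; apply: mulr_gt0 => //; exact: mulr_gt0.
exists (Num.sqrt (P * K)); split; first by rewrite sqrtr_gt0 mulr_gt0.
move=> t u1 t0 iu.
set L := 1 + pos_part (ln t); set N := \int[lebesgue_rV R n]_x Normc.normc (u1 x).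
have L0 : 0 <= L by rewrite addr_ge0// le_max lexx orbT.
have N0 : 0 <= N by apply: Rintegral_ge0 => x _; exact: normc_ge0.
rewrite Lp_norm1E// -/N -EFinM.
have -> : Num.sqrt (P * K) * L `^ (1 / 2) * N = Num.sqrt (P * (K * L * N ^+ 2)).
  have PK0 : 0 <= P * K by rewrite ltW// mulr_gt0.
  rewrite (_ : P * (K * L * N ^+ 2) = P * K * L * N ^+ 2); last by ring.
  rewrite (@sqrtrM _ (P * K * L)) ?(mulr_ge0 PK0)// (@sqrtrM _ (P * K))//.
  by rewrite sqrtr_sqr ger0_norm// div1r powR12_sqrt.
apply: Lp_norm2_le; rewrite /T_cutoff EFinM.
have ig := cutoff_u_hat_L1 cw ca w_pos a_pos r0 mR mI chiM chi0 t0 iu.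
apply: (le_trans (inv_fourier_L2_le ig)).
rewrite lee_wpmul2l ?lee_fin ?(ltW P0)//.
exact: (cutoff_u_hat_L2_le n0 cw ca w_pos a_pos c0 wc r0 M0 mR mI chiM chi0 t0 iu).
Qed.
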